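(* Let $n\geq 3$ and let $\Gamma=(\Gamma^{\alpha_1\alpha_2\cdots\alpha_n})$, $\alpha_i\in\{0,1\}^\ell$, be a blockwise symmetric signature of arity $n\ell$. If $\Gamma$ is realized by a matchgate, then there exist a condensed signature $(g_\alpha)_{\alpha\in\{0,1\}^\ell}$ realized by a matchgate with arity $\ell+1$, and a bitwise symmetric matchgate signature $\Gamma_S$ realized by a matchgate with arity $n$, such that for all $\alpha_1,\dots,\alpha_n\in\{0,1\}^\ell$, \[\Gamma^{\alpha_1\alpha_2\cdots\alpha_n}=g_{\alpha_1}g_{\alpha_2}\cdots g_{\alpha_n}\,\Gamma_S^{p(\alpha_1)p(\alpha_2)\cdots p(\alpha_n)}.\]
   Context: Strings in $\{0,1\}^{n\ell}$ are written in blockwise form $\alpha_1\alpha_2\cdots\alpha_n$ with consecutive blocks $\alpha_j\in\{0,1\}^\ell$. For a bit string $\alpha$, $p(\alpha)=0$ if its Hamming weight is even and $p(\alpha)=1$ if odd. A matchgate is a pair $(G,X)$ with $G$ a weighted undirected planar graph and $X$ a set of $N$ external nodes (its arity) ordered counterclockwise on the external face; its signature has entries $\Gamma^{i_1\cdots i_N}=\mathrm{PerfMatch}(G-Z)$ (weighted sum over perfect matchings of the product of edge weights), where $Z\subseteq X$ has characteristic sequence $i_1\cdots i_N$ and $G-Z$ removes $Z$ and its incident edges; $\Gamma$ is realized by the matchgate, and a matchgate signature is one so realized. A matchgate is even (resp. odd) if it has an even (resp. odd) number of nodes. The condensed signature of an even (resp. odd) matchgate with signature $\Gamma$ of arity $m$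 is the vector $(g_\alpha)_{\alpha\in\{0,1\}^{m-1}}$ with $g_\alpha=\Gamma^{\alpha b}$ (resp. $g_\alpha=\Gamma^{\alpha\bar b}$) where $b=p(\alpha)$ and $\bar b=1-b$; such $g$ is said to be realized by that matchgate. $\Gamma$ is blockwise symmetric if $\Gamma^{\alpha_1\cdots\alpha_n}=\Gamma^{\alpha_{\sigma(1)}\cdots\alpha_{\sigma(n)}}$ for every permutation $\sigma$ of $\{1,\dots,n\}$; a signature of arity $n$ is bitwise symmetric if it is blockwise symmetric with block size $1$, i.e. invariant under all permutations of its $n$ bits. *)

(* Defs.v *)
From mathcomp Require Import all_boot all_fingroup all_algebra.

Set Implicit Arguments.
Unset Strict Implicit.
Unset Printing Implicit Defensive.

Import GRing.Theory.
Local Open Scope ring_scope.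

(* A simple graph on T is its set E : {set {set T}} of two-element edges.     *)

Definition adj (T : finType) (E : {set {set T}}) : rel T :=
  fun u v => [set u; v] \in E.

(* An embedding in an oriented surface is given by the rotation of the        *)
(* neighbours around each node: r u sends a neighbour of u to the next one,   *)
(* clockwise.  The values of r u off the neighbours of u are irrelevant; they *)
(* are there so that r u, and hence face_step r, is a permutation.            *)
Definition rotation_system (T : finType) (E : {set {set T}})
    (r : T -> {perm T}) : Prop :=
  forall u v, adj E u v -> porbit (r u) v = [set w | adj E u w].

(* Darts are ordered pairs of adjacent nodes; the faces of the embedding are  *)
(* the orbits on darts of the map below.                                      *)
Definition face_step (T : finType) (r : T -> {perm T}) (d : T * T) : T * T :=
  (d.2, r d.2 d.1).

(* Euler's formula V + F = E + 2C, i.e. genus 0, for the components that have *)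
(* an edge (cover E is the set of non-isolated nodes).  F counts the face     *)
(* orbits of each component separately, whence 2C instead of 1 + C.  Isolated *)
(* nodes have no darts and never obstruct planarity.                          *)
Definition genus0 (T : finType) (E : {set {set T}})
    (r : T -> {perm T}) : Prop :=
  (#|cover E| + fcard (face_step r) [pred d : T * T | adj E d.1 d.2]
   = #|E| + 2 * n_comp (adj E) (cover E))%N.

(* The graph obtained by placing a new node None in the external face and     *)
(* joining it to the external nodes.                                          *)
Definition add_infinity (V : finType) (E : {set {set V}}) (N : nat)
    (x : 'I_N -> V) : {set {set option V}} :=
  [set [set Some u | u in e] | e : {set V} in E]
    :|: [set [set None; Some (x i)] | i : 'I_N].

(* (V, E) has a planar drawing with x 0, ..., x N.-1 lying counterclockwise   *)
(* on the external face: equivalently, the drawing extends to one on the      *)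
(* sphere of the graph with the point at infinity joined to the x i.  The     *)
(* counterclockwise order of the x i as seen from the plane is their          *)
(* clockwise order as seen from infinity.  Going through infinity also        *)
(* handles disconnected graphs, whose external face is bounded by several     *)
(* closed walks, and nodes occurring several times on such a walk.            *)
Definition plane_with_external (V : finType) (E : {set {set V}}) (N : nat)
    (x : 'I_N -> V) : Prop :=
  exists r : option V -> {perm option V},
    [/\ rotation_system (add_infinity E x) r,
        forall i : 'I_N, r None (Some (x i)) = Some (x (ordS i))
      & genus0 (add_infinity E x) r].

Record matchgate (F : fieldType) (N : nat) := Matchgate {
  node : finType;
  edges : {set {set node}};
  weight : {set node} -> F;
  ext : 'I_N -> node;
  edges_card2 : forall e, e \in edges -> #|e| = 2%N;
  ext_inj : injective ext;
  ext_plane : plane_with_external edges ext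
}.

(* PerfMatch (G - Z). *)
Definition perf_match (F : fieldType) (N : nat) (G : matchgate F N)
    (Z : {set node G}) : F :=
  \sum_(M : {set {set node G}} | (M \subset edges G) && partition M (~: Z))
    \prod_(e in M) weight e.

Definition signature (F : fieldType) (N : nat) (G : matchgate F N)
    (b : N.-tuple bool) : F :=
  perf_match [set ext G i | i : 'I_N & tnth b i].

Definition realizes (F : fieldType) (N : nat) (G : matchgate F N)
    (Gam : N.-tuple bool -> F) : Prop :=
  forall b, Gam b = signature G b.

Definition parity (l : nat) (a : l.-tuple bool) : bool := odd (count id a).

Definition odd_matchgate (F : fieldType) (N : nat) (G : matchgate F N) : bool :=
  odd #|node G|.

Definition realizes_condensed (F : fieldType) (l : nat) (G : matchgate F l.+1)
    (g : l.-tuple bool -> F) : Prop :=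
  forall a, g a = signature G
    (rcons_tuple a (if odd_matchgate G then ~~ parity a else parity a)).

Lemma size_blocks (n l : nat) (a : n.-tuple (l.-tuple bool)) :
  size (flatten [seq val x | x <- a]) == (n * l)%N.
Proof.
case: a => s /= /eqP <-; elim: s => //= x s IHs.
by rewrite size_cat size_tuple (eqP IHs) mulSn.
Qed.

Definition blocks (n l : nat) (a : n.-tuple (l.-tuple bool)) :
  (n * l).-tuple bool := Tuple (size_blocks a).

Definition blockwise_symmetric (F : fieldType) (n l : nat)
    (Gam : (n * l).-tuple bool -> F) : Prop :=
  forall (s : 'S_n) (a : n.-tuple (l.-tuple bool)),
    Gam (blocks a) = Gam (blocks [tuple tnth a (s i) | i < n]).

Definition bitwise_symmetric (F : fieldType) (n : nat)
    (Gam : n.-tuple bool -> F) : Prop :=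
  forall (s : 'S_n) (b : n.-tuple bool),
    Gam b = Gam [tuple tnth b (s i) | i < n].

(* Main.v *)
Require Import Defs.
From mathcomp Require Import all_boot all_fingroup all_algebra.
From mathcomp Require Import zify ring.

(* The proof rests on the matchgate identities, quadratic relations between the
   entries of a matchgate signature.  Superpose a perfect matching counted by
   the entry at X + p with one counted by the entry at Y + p: the component of
   the external node p is a path, whose other end is an external node q where X
   and Y differ.  Exchanging the two matchings along this path is an involution,
   and it reverses signs because disjoint paths between external nodes cannot
   cross.  The latter is read off the homological form of Euler's formula: in a
   genus 0 embedding every cycle mod 2 is the boundary of a set of faces.  In
   this form planarity is also visibly inherited by the subgraphs and
   subdivisions that realize the two factors of the theorem.

   Comparing the identities for two orders of the blocks shows, as 2 != 0, that
   Gam X * Gam Y does not change when X and Y exchange a block on which they have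
   the same parity.  Hence each block alpha contributes a factor g alpha, read
   off the slice of Gam through one full block and one further bit, and what
   remains depends only on the parities: it is Gam with one free bit per block,
   rescaled bitwise. *)

Set Implicit Arguments.
Unset Strict Implicit.
Unset Printing Implicit Defensive.

Import GRing.Theory.
Local Open Scope ring_scope.

(** * Euler's formula as a homological statement *)

Section InvariantRank.

Variable D : finType.
Implicit Types (v w : 'rV[bool]_#|D|) (f g : D -> D) (d : D).

Lemma rank_invariants m (A : 'M[bool]_(m, #|D|)) (e : rel D) :
    connect_sym e ->
    (forall v, (v <= A)%MS <->
       (forall x y, e x y -> v 0 (enum_rank x) = v 0 (enum_rank y))) ->
  \rank A = n_comp e D.
Proof.
move=> sym_e AP.
pose R := [set x | roots e x].
have <- : #|R| = n_comp e D by apply: eq_card => x; rewrite !inE andbT.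
pose B : 'M[bool]_(#|R|, #|D|) :=
  \matrix_(k, j) (fingraph.root e (enum_val j) == enum_val k).
have B_free : row_free B.
  apply/row_freeP; exists (\matrix_(j, k) (enum_val j == enum_val k)).
  apply/matrixP=> k k'; rewrite !mxE (bigD1 (enum_rank (enum_val k'))) //=.
  rewrite !mxE enum_rankK eqxx mulr1 big1 ?addr0 => [|j].
    have /eqP-> : fingraph.root e (enum_val k') == enum_val k'.
      by have := enum_valP k'; rewrite inE.
    by rewrite (inj_eq enum_val_inj) eq_sym; case: (k == k').
  rewrite [(\matrix_(_, _) (_ == _)) j k']mxE => j_neq.
  case: eqP => [jk|]; last by rewrite mulr0.
  by rewrite -jk enum_valK eqxx in j_neq.
have invP v : (forall x y, e x y -> v 0 (enum_rank x) = v 0 (enum_rank y)) ->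
    forall x y, connect e x y -> v 0 (enum_rank x) = v 0 (enum_rank y).
  move=> inv_v x y /connectP[p e_p ->].
  by elim: p x e_p => //= z p IHp x /andP[/inv_v-> /IHp].
have /eqmxP eqAB : (A == B)%MS; last by rewrite eqAB; apply/eqP.
apply/andP; split; apply/row_subP=> k.
  have {}/invP inv_k := (AP _).1 (row_sub k A).
  apply/submxP; exists (\row_j row k A 0 (enum_rank (enum_val j))).
  apply/rowP=> j; rewrite [RHS]mxE.
  have root_in : fingraph.root e (enum_val j) \in R by rewrite inE roots_root.
  rewrite (bigD1 (enum_rank_in root_in (fingraph.root e (enum_val j)))) //=.
  rewrite [X in _ + X]big1 ?addr0 => [|i].
    rewrite [B _ _]mxE enum_rankK_in // eqxx mulr1 [RHS]mxE enum_rankK_in //.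
    have := inv_k (enum_val j) _ (connect_root e _).
    by rewrite enum_valK !mxE.
  rewrite [B i j]mxE => i_neq; case: eqP => [iE|_]; last by rewrite mulr0.
  case/eqP: i_neq; apply: enum_val_inj.
  by rewrite enum_rankK_in // iE.
apply/AP=> x y e_xy; rewrite !mxE !enum_rankK.
by rewrite ((fingraph.rootP sym_e) (connect1 e_xy)).
Qed.

Definition pullback_mx f : 'M[bool]_#|D| :=
  \matrix_(i, j) (i == enum_rank (f (enum_val j))).

Lemma pullback_mxE f v d :
  (v *m pullback_mx f) 0 (enum_rank d) = v 0 (enum_rank (f d)).
Proof.
rewrite mxE (bigD1 (enum_rank (f d))) //= mxE enum_rankK eqxx mulr1 big1 ?addr0//.
by move=> i; rewrite mxE enum_rankK => /negPf->; rewrite mulr0.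
Qed.

Lemma rowP_enum v w :
  (forall d, v 0 (enum_rank d) = w 0 (enum_rank d)) -> v = w.
Proof. by move=> eq_vw; apply/rowP=> j; rewrite -(enum_valK j) eq_vw. Qed.

Lemma addmx_bool m n (A B : 'M[bool]_(m, n)) : A + B = 0 -> A = B.
Proof.
move/matrixP=> AB; apply/matrixP=> i j.
by move: (AB i j); rewrite !mxE; case: (A i j); case: (B i j).
Qed.

Lemma addmxx_bool m n (A : 'M[bool]_(m, n)) : A + A = 0.
Proof. by apply/matrixP=> i j; rewrite !mxE; case: (A i j). Qed.

Definition inv_mx f := kermx (1%:M + pullback_mx f).

Lemma inv_mxP f v :
  reflect (forall d, v 0 (enum_rank (f d)) = v 0 (enum_rank d))
          (v <= inv_mx f)%MS.
Proof.
apply: (iffP sub_kermxP) => [|inv_v]; rewrite mulmxDr mulmx1.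
  by move/addmx_bool=> eq_v d; rewrite {2}eq_v pullback_mxE.
suff -> : v *m pullback_mx f = v by apply: addmxx_bool.
by apply: rowP_enum => d; rewrite pullback_mxE.
Qed.

Lemma rank_inv_mx f : injective f -> \rank (inv_mx f) = fcard f D.
Proof.
move=> inj_f; apply: rank_invariants; first exact: fconnect_sym.
move=> v; split=> [/inv_mxP inv_v x _ /eqP<- | inv_v]; first by rewrite inv_v.
by apply/inv_mxP=> d; rewrite (inv_v d (f d)) //=.
Qed.

Lemma rank_inv2_mx f g : injective f -> injective g ->
  \rank (inv_mx f :&: inv_mx g)%MS = n_comp (relU (frel f) (frel g)) D.
Proof.
move=> inj_f inj_g; apply: rank_invariants.
  by apply: relU_sym; apply: fconnect_sym.
move=> v; rewrite sub_capmx; split=> [/andP[/inv_mxP f_v /inv_mxP g_v] x y|inv_v].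
  by case/orP=> /eqP<-; rewrite ?f_v ?g_v.
by apply/andP; split; apply/inv_mxP=> d;
  rewrite -(inv_v d) //=; apply/orP; [left|right].
Qed.

End InvariantRank.

(* Over F_2, with n the rotations around the nodes, e the reversal of darts and
   n \o e the face permutation, Euler's formula says that the boundaries
   (1 + e) Inv(n \o e), which have dimension F - C, exhaust the cycles, i.e. the
   orthogonal of Inv(e) + Inv(n), of dimension 2E - (E + V - C). *)
Section EulerHomology.

Variables (D : finType) (n e : D -> D).
Hypotheses (inj_n : injective n) (eK : involutive e) (e_neq : forall d, e d != d).

Let phi d := n (e d).

Definition dart_cycle (c : D -> bool) :=
  (forall d, c (e d) = c d) /\
  (forall w : D -> bool, (forall d, w (n d) = w d) -> \sum_d w d * c d = 0).

Definition dart_boundary (c : D -> bool) :=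
  exists2 f : D -> bool, forall d, f (phi d) = f d & forall d, f d + f (e d) = c d.

Let inj_e : injective e := inv_inj eK.
Let inj_phi : injective phi. Proof. by move=> x y /inj_n/inj_e. Qed.

Lemma card_darts : #|D| = (2 * fcard e D)%N.
Proof.
rewrite mulnC (@fcard_order_set D e _ 2%N) //; apply/subsetP=> d _.
rewrite inE; apply/eqP; rewrite -size_orbit.
have := orbit_uniq e d; have := size_orbit e d.
have : e d \in fingraph.orbit e d by rewrite -fconnect_orbit fconnect1.
rewrite /fingraph.orbit; case: (fingraph.order e d) => [|[|[|m]]] //=.
  by rewrite inE (negPf (e_neq d)).
by rewrite eK => _ _; rewrite !inE eqxx !orbT.
Qed.

Let dot (v w : 'rV[bool]_#|D|) : (v *m w^T) 0 0 =
  \sum_d v 0 (enum_rank d) * w 0 (enum_rank d).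
Proof.
rewrite mxE (reindex_onto (@enum_rank D) (@enum_val D predT)) /=; last first.
  by move=> i _; apply: enum_valK.
by apply: eq_big => [d|d _]; rewrite ?enum_rankK ?eqxx // mxE.
Qed.

Let sum_e_inv (g : D -> bool) : (forall d, g (e d) = g d) -> \sum_d g d = 0.
Proof.
move=> inv_g; pose h d := g d && (enum_rank d < enum_rank (e d))%N.
have gE d : g d = h d + h (e d).
  rewrite /h eK inv_g; have := e_neq d.
  rewrite -(inj_eq enum_rank_inj) -val_eqE /=.
  by case: ltngtP => // _ _; case: (g d).
under eq_bigr do rewrite gE.
rewrite big_split /= [X in _ + X](reindex_inj inj_e) /=.
under [X in _ + X]eq_bigr do rewrite eK.
by case: (\sum_d h d).
Qed.

Let A := inv_mx n.
Let B := inv_mx e.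
Let P := inv_mx phi.
Let Z := kermx (col_mx A B)^T.
Let I := P *m (1%:M + pullback_mx e).

Let orthP m (C : 'M[bool]_(m, #|D|)) (v : 'rV[bool]_#|D|) :
  (forall w : 'rV_#|D|, (w <= C)%MS -> \sum_d w 0 (enum_rank d) * v 0 (enum_rank d) = 0)
  <-> C *m v^T = 0.
Proof.
split=> [orth|Cv w /submxP[u ->]].
  apply/row_matrixP=> i; rewrite row_mul row0; apply/rowP=> j.
  by rewrite ord1 dot orth ?row_sub // mxE.
by rewrite -dot -mulmxA Cv mulmx0 mxE.
Qed.

Let ZP (v : 'rV[bool]_#|D|) :
  (v <= Z)%MS <-> dart_cycle (fun d => v 0 (enum_rank d)).
Proof.
have -> : (v <= Z)%MS = (A *m v^T == 0) && (B *m v^T == 0).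
  rewrite -[RHS]andbT; apply/sub_kermxP/idP.
    move/(congr1 trmx); rewrite trmx_mul trmxK trmx0 mul_col_mx => /eqP.
    by rewrite col_mx_eq0 andbT.
  rewrite andbT -col_mx_eq0 -mul_col_mx => /eqP/(congr1 trmx).
  by rewrite trmx_mul trmxK trmx0.
split=> [/andP[/eqP/orthP Av /eqP/orthP Bv]|[ve vn]]; last first.
  apply/andP; split; apply/eqP/orthP=> w /inv_mxP inv_w.
    exact: (vn (fun d => w 0 (enum_rank d))).
  by apply: sum_e_inv => d; rewrite inv_w ve.
split=> [d|w inv_w].
  pose u : 'rV[bool]_#|D| := \row_j ((enum_val j == d) || (enum_val j == e d)).
  have uE x : u 0 (enum_rank x) = (x == d) || (x == e d).
    by rewrite mxE enum_rankK.
  have /Bv : (u <= B)%MS.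
    apply/inv_mxP=> x; rewrite !uE orbC (inj_eq inj_e).
    by rewrite -{2}(eK d) (inj_eq inj_e).
  rewrite (bigD1 d) // (bigD1 (e d)) //= big1 => [|x /andP[xd xed]].
    by rewrite !uE !eqxx orbT; case: (v 0 _); case: (v 0 _).
  by rewrite uE (negPf xd) (negPf xed).
have := Av (\row_j w (enum_val j)).
rewrite (eq_bigr (fun d => w d * v 0 (enum_rank d))) => [->//|d _].
  by apply/inv_mxP=> d; rewrite !mxE !enum_rankK.
by rewrite mxE enum_rankK.
Qed.

Let IP (v : 'rV[bool]_#|D|) :
  (v <= I)%MS <-> dart_boundary (fun d => v 0 (enum_rank d)).
Proof.
split=> [/submxP[u ->]|[f inv_f fE]].
  exists (fun d => (u *m P) 0 (enum_rank d)).
    exact/inv_mxP/submxMl.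
  by move=> d; rewrite /I mulmxA mulmxDr mulmx1 [RHS]mxE pullback_mxE.
have /submxP[u uE] : (\row_j f (enum_val j) <= P)%MS.
  by apply/inv_mxP=> d; rewrite !mxE !enum_rankK.
apply/submxP; exists u; apply: rowP_enum => d.
rewrite /I mulmxA -uE mulmxDr mulmx1 [RHS]mxE pullback_mxE.
by rewrite 2!mxE !enum_rankK fE.
Qed.

Let sub_IZ : (I <= Z)%MS.
Proof.
apply/row_subP=> i; apply/ZP; have /IP[f inv_f fE] := row_sub i I.
split=> [d|w inv_w]; first by rewrite -!fE eK addrC.
under eq_bigr do rewrite -fE mulrDr.
rewrite big_split /= [X in X + _](reindex_inj inj_n) /=.
have fn d : f (n d) = f (e d) by rewrite -(inv_f (e d)) /phi eK.
under eq_bigr do rewrite inv_w fn.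
by case: (\sum_d _).
Qed.

Lemma euler_homology :
  (fcard n D + fcard phi D = fcard e D + 2 * n_comp (relU (frel n) (frel e)) D)%N
  <-> forall c, dart_cycle c -> dart_boundary c.
Proof.
have rankA := rank_inv_mx inj_n; have rankB := rank_inv_mx inj_e.
have rankP := rank_inv_mx inj_phi; have rankAB := rank_inv2_mx inj_n inj_e.
rewrite -/A in rankA rankAB; rewrite -/B in rankB rankAB; rewrite -/P in rankP.
have eqPB : (P :&: B :=: A :&: B)%MS.
  apply/eqmxP/andP; split; apply/row_subP=> i.
    have := row_sub i (P :&: B)%MS.
    rewrite !sub_capmx => /andP[/inv_mxP inv1 inv2]; rewrite inv2 andbT.
    have /inv_mxP inv_e := inv2; apply/inv_mxP=> d.
    by rewrite -{1}(eK d) inv1 inv_e.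
  have := row_sub i (A :&: B)%MS.
  rewrite !sub_capmx => /andP[/inv_mxP inv1 inv2]; rewrite inv2 andbT.
  have /inv_mxP inv_e := inv2; apply/inv_mxP=> d.
  by rewrite /phi inv1 inv_e.
have rankI : (\rank I + \rank (A :&: B)%MS = \rank P)%N.
  by rewrite -eqPB mxrank_mul_ker.
have rankZ : (\rank Z + (\rank A + \rank B) = #|D| + \rank (A :&: B)%MS)%N.
  rewrite -mxrank_sum_cap mxrank_ker mxrank_tr (addsmxE A B) addnA.
  by rewrite subnK // rank_leq_col.
have := mxrank_leqif_sup sub_IZ; have cardD := card_darts.
case=> _ eq_rank.
transitivity (\rank I = \rank Z); first by split; lia.
transitivity (is_true (Z <= I)%MS).
  by rewrite -eq_rank; split=> /eqP.
split=> [sZI c c_cyc | all_bd].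
  have [|f inv_f fE] := (IP (\row_j c (enum_val j))).1.
    apply: submx_trans sZI; apply/ZP; case: c_cyc => c_e c_n.
    split=> [d|w inv_w]; first by rewrite !mxE !enum_rankK.
    by rewrite -[RHS](c_n w inv_w); apply: eq_bigr => d _; rewrite mxE enum_rankK.
  by exists f => // d; rewrite fE mxE enum_rankK.
by apply/row_subP=> i; apply/IP/all_bd/ZP/row_sub.
Qed.

End EulerHomology.

Section GraphHomology.

Variables (T : finType) (E : {set {set T}}).

Definition simple_graph := forall e, e \in E -> #|e| = 2%N.

Definition chain_cycle (c : {set T} -> bool) :=
  forall u, \sum_(e in E | u \in e) c e = 0.

Definition chain_boundary (r : T -> {perm T}) (c : {set T} -> bool) :=
  exists2 f : T -> T -> bool,
    forall u v, adj E u v -> f v (r v u) = f u v &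
    forall u v, adj E u v -> f u v + f v u = c [set u; v].

Lemma adj_sym : symmetric (adj E).
Proof. by move=> u v; rewrite /adj setUC. Qed.

Hypothesis simpleE : simple_graph.

Lemma adj_neq u v : adj E u v -> u != v.
Proof. by move/simpleE; rewrite cards2; case: eqP. Qed.

Lemma edge_other u e :
  e \in E -> u \in e -> exists2 v, adj E u v & e = [set u; v].
Proof.
move=> Ee ue; have /eqP/cards2P[x [y [_ eE]]] := simpleE Ee.
rewrite {}eE in Ee ue *; move: ue; rewrite !inE => /orP[]/eqP->.
  by exists y.
by exists x; rewrite 1?adj_sym // setUC.
Qed.

Lemma set2_inj (u v w : T) : [set u; v] = [set u; w] -> v = w.
Proof.
move/setP=> eq_uvw; move: (eq_uvw v) (eq_uvw w) (eq_uvw u); rewrite !inE !eqxx !orbT.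
by move=> /esym/orP[]/eqP-> // /orP[]/eqP->.
Qed.

Variable r : T -> {perm T}.
Hypothesis rotr : rotation_system E r.

Lemma adj_rot u v : adj E u (r u v) = adj E u v.
Proof.
apply/idP/idP=> uv; have /setP orb := rotr uv.
  by have := orb v; rewrite inE => <-; rewrite porbit_sym (mem_porbit _ 1).
by have := orb (r u v); rewrite inE => <-; apply: (mem_porbit _ 1).
Qed.

Definition dart := {d : T * T | adj E d.1 d.2}.
Implicit Type d : dart.

Definition dart_rot d : dart :=
  exist _ ((val d).1, r (val d).1 (val d).2)
    (etrans (adj_rot (val d).1 (val d).2) (valP d)).

Definition dart_rev d : dart :=
  exist _ ((val d).2, (val d).1) (etrans (adj_sym _ _) (valP d)).

Lemma dart_rot_inj : injective dart_rot.
Proof.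
move=> [[u v] uv] [[u' v'] uv'] /(congr1 val)[/= eq_u]; apply: contra_eq => neq.
by rewrite eq_u (inj_eq perm_inj); apply: contraNneq neq => eq_v;
  apply/eqP/val_inj; rewrite /= eq_u eq_v.
Qed.

Lemma dart_revK : involutive dart_rev.
Proof. by move=> [[u v] uv]; apply: val_inj. Qed.

Lemma dart_rev_neq d : dart_rev d != d.
Proof.
apply/eqP=> /(congr1 val)/=; case: d => [[u v] /= uv] [vu _].
by have := adj_neq uv; rewrite vu eqxx.
Qed.

Lemma connect_dart_rot d d' :
  fconnect dart_rot d d' = ((val d).1 == (val d').1).
Proof.
apply/idP/eqP=> [/iter_findex <-|].
  by elim: (findex _ _ _) => //= k IHk.
case: d d' => [[u v] uv] [[u' v'] uv'] /= eq_u; rewrite -{}eq_u in uv' *.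
have /porbitP[k v'E] : v' \in porbit (r u) v by rewrite (rotr uv) inE.
suff <- : iter k dart_rot (exist _ (u, v) uv) = exist _ (u, v') uv'.
  exact: fconnect_iter.
apply: val_inj; rewrite /= {}v'E permX; elim: k {uv'} => //= k IHk.
by rewrite IHk.
Qed.

Lemma connect_dart_rev d d' :
  fconnect dart_rev d d' =
  ([set (val d).1; (val d).2] == [set (val d').1; (val d').2]).
Proof.
apply/idP/eqP=> [/iter_findex <-|].
  by elim: (findex _ _ _) => //= k ->; rewrite setUC.
case: d d' => [[u v] uv] [[u' v'] uv'] /= eq_e.
have: u' \in [set u; v] by rewrite eq_e set21.
rewrite !inE => /orP[]/eqP eq_u; subst u'.
  have eq_v := set2_inj eq_e; subst v'.
  by rewrite (bool_irrelevance uv' uv).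
rewrite setUC in eq_e; have eq_v := set2_inj eq_e; subst v'.
have := fconnect1 dart_rev (exist (fun d : T * T => adj E d.1 d.2) (u, v) uv).
by congr (fconnect _ _ _); apply: val_inj.
Qed.

Lemma connect_darts d d' :
  connect (relU (frel dart_rot) (frel dart_rev)) d d'
  = connect (adj E) (val d).1 (val d').1.
Proof.
set U := relU _ _.
have sub_rot x y : (val x).1 = (val y).1 -> connect U x y.
  move/eqP; rewrite -connect_dart_rot; apply: connect_sub => {}x {}y xy.
  by apply: connect1; apply/orP; left.
apply/idP/idP.
  case/connectP=> p U_p ->; elim: p d U_p => //= x p IHp d /andP[dx /IHp].
  apply: connect_trans; case/orP: dx => /eqP <- //.
  by apply: connect1; apply: (valP d).
case/connectP=> p; elim: p d => [|v p IHp] d /=.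
  by move=> _ eq_d; apply: sub_rot.
case/andP=> uv v_p last_p; pose x : dart := exist _ (_, _) uv.
apply: (connect_trans (sub_rot d x _)) => //.
apply: connect_trans (IHp (dart_rev x) v_p last_p).
by apply: connect1; apply/orP; right; apply/eqP.
Qed.

Let eqrel (S : finType) : rel S := fun x y => x == y.

Let connect_eqrel (S : finType) : connect (@eqrel S) =2 @eqrel S.
Proof.
move=> x y; apply/idP/eqP=> [/connectP[p + ->]|->]; last exact: connect0.
by elim: p x => //= z p IHp x /andP[/eqP-> /IHp].
Qed.

Let eqrel_sym (S : finType) : connect_sym (@eqrel S).
Proof. by move=> x y; rewrite !connect_eqrel /eqrel eq_sym. Qed.

Let n_comp_eqrel (S : finType) (A : {set S}) : n_comp (@eqrel S) A = #|A|.
Proof.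
apply: eq_card => x; rewrite !inE.
have := connect_root (@eqrel S) x; rewrite connect_eqrel => /eqP eq_x.
by rewrite /roots -eq_x eqxx.
Qed.

Let fibre_count (S : finType) (e : rel S) (A : {pred S}) (h : dart -> S)
    (e' : rel dart) :
    connect_sym e -> connect_sym e' -> closed e A ->
    (forall d, h d \in A) -> (forall x, x \in A -> exists d, h d = x) ->
    (forall d d', connect e' d d' = connect e (h d) (h d')) ->
  n_comp e' {: dart} = n_comp e A.
Proof.
move=> sym_e sym_e' cl_A hA surj_h eq_e; rewrite (adjunction_n_comp h sym_e sym_e' cl_A).
  by apply: eq_n_comp_r => d; rewrite !inE hA.
split=> [x Ax|d d' _]; last exact: eq_e.
apply: (@sigW _ (fun d : dart => connect e x (h d))).
by have [d <-] := surj_h x Ax; exists d; apply: connect0.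
Qed.

Let eqrel_closed (S : finType) (A : {pred S}) : closed (@eqrel S) A.
Proof. by move=> x y /eqP->. Qed.

Lemma fcard_dart_rot : fcard dart_rot {: dart} = #|cover E|.
Proof.
rewrite -n_comp_eqrel; apply: (@fibre_count _ _ _ (fun d => (val d).1)) => //.
- exact: fconnect_sym dart_rot_inj.
- move=> d; apply/bigcupP; exists [set (val d).1; (val d).2]; first exact: (valP d).
  exact: set21.
- move=> u /bigcupP[e Ee ue]; have [v uv _] := edge_other Ee ue.
  by exists (exist _ (u, v) uv).
by move=> d d'; rewrite connect_dart_rot connect_eqrel.
Qed.

Lemma fcard_dart_rev : fcard dart_rev {: dart} = #|E|.
Proof.
rewrite -n_comp_eqrel.
apply: (@fibre_count _ _ _ (fun d => [set (val d).1; (val d).2])) => //.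
- exact: fconnect_sym (inv_inj dart_revK).
- by move=> d; apply: (valP d).
- move=> e Ee; have /eqP/cards2P[u [v [_ eE]]] := simpleE Ee.
  by rewrite eE in Ee *; exists (exist _ (u, v) Ee).
by move=> d d'; rewrite connect_dart_rev connect_eqrel.
Qed.

Lemma n_comp_darts :
  n_comp (relU (frel dart_rot) (frel dart_rev)) {: dart} = n_comp (adj E) (cover E).
Proof.
apply: (@fibre_count _ _ _ (fun d => (val d).1)).
- exact: sym_connect_sym adj_sym.
- apply: relU_sym; apply: fconnect_sym; first exact: dart_rot_inj.
  exact: inv_inj dart_revK.
- apply: intro_closed; first exact: sym_connect_sym adj_sym.
  by move=> u v uv _; apply/bigcupP; exists [set u; v]; rewrite ?set22.
- move=> d; apply/bigcupP; exists [set (val d).1; (val d).2]; first exact: (valP d).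
  exact: set21.
- move=> u /bigcupP[e Ee ue]; have [v uv _] := edge_other Ee ue.
  by exists (exist _ (u, v) uv).
exact: connect_darts.
Qed.

Lemma face_step_inj : injective (face_step r).
Proof. by move=> [u v] [u' v'] [-> /perm_inj->]. Qed.

Lemma fcard_dart_face :
  fcard (fun d => dart_rot (dart_rev d)) {: dart}
  = fcard (face_step r) [pred d : T * T | adj E d.1 d.2].
Proof.
apply: (@fibre_count _ _ _ val).
- exact: fconnect_sym face_step_inj.
- by apply: fconnect_sym => d d' /dart_rot_inj/(inv_inj dart_revK).
- move=> [u v] _ /eqP<-; rewrite !inE /=.
  by rewrite [in RHS]adj_rot [RHS]adj_sym.
- by move=> d; rewrite inE; apply: (valP d).
- by move=> d Dd; exists (exist _ d Dd).
move=> d d'.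
have val_iter k : val (iter k (fun d => dart_rot (dart_rev d)) d)
    = iter k (face_step r) (val d) by elim: k => //= k <-.
apply/idP/idP=> /iter_findex => [<-|]; first by rewrite val_iter fconnect_iter.
by rewrite -val_iter => /val_inj <-; apply: fconnect_iter.
Qed.

Lemma sum_at_node u (g : {set T} -> bool) :
  \sum_(d : dart | (val d).1 == u) g [set (val d).1; (val d).2]
  = \sum_(e in E | u \in e) g e.
Proof.
rewrite (partition_big (fun d : dart => [set (val d).1; (val d).2])
          (fun e => (e \in E) && (u \in e))) /=; last first.
  by move=> d /eqP<-; rewrite set21 andbT; apply: (valP d).
apply: eq_bigr => e /andP[Ee ue]; have [v uv eE] := edge_other Ee ue.
rewrite (big_pred1 (exist _ (u, v) uv)) => [|[[u' v'] uv']] /=; first by rewrite -eE.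
apply/andP/eqP=> [[/eqP eq_u /eqP]|[eq_u eq_v]]; last first.
  by rewrite eq_u eq_v eqxx eE.
rewrite eq_u in uv' *; rewrite eE => /set2_inj eq_v; apply: val_inj.
by rewrite /= eq_v.
Qed.

Theorem genus0_homology :
  genus0 E r <-> forall c, chain_cycle c -> chain_boundary r c.
Proof.
rewrite /genus0 -fcard_dart_rot -fcard_dart_rev -n_comp_darts -fcard_dart_face.
apply: iff_trans (euler_homology dart_rot_inj dart_revK dart_rev_neq) _.
split=> [all_bd c c_cyc|all_bd cd [cd_rev cd_rot]].
  have [|f f_face fE] := all_bd (fun d => c [set (val d).1; (val d).2]).
    split=> [d|w w_rot]; first by rewrite /= setUC.
    rewrite (partition_big (fun d : dart => (val d).1) predT) //= big1 // => u _.
    have [d0 /eqP d0u|no_d] := pickP (fun d : dart => (val d).1 == u); last first.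
      by rewrite big_pred0.
    rewrite (eq_bigr (fun d => w d0 * c [set (val d).1; (val d).2])) => [|d /eqP du].
      by rewrite -mulr_sumr sum_at_node c_cyc mulr0.
    congr (_ * _); have: fconnect dart_rot d d0 by rewrite connect_dart_rot du d0u.
    by apply: fconnect_invariant => x; apply/eqP/w_rot.
  pose g u v := if insub (u, v) is Some d then f d else false.
  have gE (d : dart) : g (val d).1 (val d).2 = f d.
    by rewrite /g -surjective_pairing valK.
  exists g => u v uv; pose d : dart := exist _ (u, v) uv.
    exact: etrans (gE (dart_rot (dart_rev d))) (etrans (f_face d) (esym (gE d))).
  rewrite -[c _]/(c [set (val d).1; (val d).2]) -fE -(gE d).
  by rewrite -(gE (dart_rev d)).
pose c e := [exists d : dart, ([set (val d).1; (val d).2] == e) && cd d].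
have cE d : c [set (val d).1; (val d).2] = cd d.
  apply/existsP/idP=> [[d' /andP[/eqP eq_d]]|cd_d]; last first.
    by exists d; rewrite eqxx.
  suff -> : cd d' = cd d by [].
  have: fconnect dart_rev d' d by rewrite connect_dart_rev eq_d.
  by apply: fconnect_invariant => x; apply/eqP/cd_rev.
have [|f f_face fE] := all_bd c.
  move=> u; rewrite -sum_at_node -[RHS](cd_rot (fun d => (val d).1 == u)) //.
  rewrite [LHS]big_mkcond; apply: eq_bigr => d _; rewrite cE.
  by case: eqP => _; rewrite ?mul1r ?mul0r.
exists (fun d => f (val d).1 (val d).2) => d; first exact: f_face (valP d).
by rewrite -cE; apply: fE (valP d).
Qed.

End GraphHomology.

(** * Matchings and alternating paths *)

Lemma sum_bool_odd (I : finType) (P b : pred I) :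
  \sum_(i | P i) b i = odd #|[pred i | P i && b i]| :> bool.
Proof.
rewrite -sum1_card (big_morph odd oddD (erefl _)) big_mkcondr /=.
by apply: eq_bigr => i _; case: (b i).
Qed.

Section Dihedral.

Variables (T : finType) (m m' : T -> T) (c : T).
Hypotheses (mK : involutive m) (m'K : involutive m') (m'c : m' c = c).

Let f x := m (m' x).
Let inj_f : injective f. Proof. by move=> x y /(inv_inj mK)/(inv_inj m'K). Qed.

Let iter_order_c : iter (fingraph.order f c) f c = c.
Proof. exact: iter_order. Qed.

Let m_f k : (k <= fingraph.order f c)%N ->
  m' (iter k f c) = iter (fingraph.order f c - k) f c.
Proof.
move=> le_k; have iter_inj a : injective (iter a f).
  by elim: a => [|a IHa] x y //= /inj_f/IHa.
apply: (iter_inj k); rewrite -iterD subnKC // iter_order_c.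
elim: k {le_k} => [|k IHk] //; rewrite iterSr -[RHS]IHk; congr iter.
by rewrite iterS /f m'K mK.
Qed.

Lemma dihedral_orbit :
  exists2 d, fconnect f c d &
    forall v, fconnect f c v ->
    [/\ fconnect f c (m v), fconnect f c (m' v) &
        ((m v == v) + (m' v == v) = (v == c) + (v == d))%N].
Proof.
set k := fingraph.order f c; have k_gt0 : (0 < k)%N by apply: fingraph.order_gt0.
have fkc : iter k f c = c := iter_order_c.
exists (iter (uphalf k) f c) => [|v cv]; first exact: fconnect_iter.
have [i lt_ik ->] : exists2 i, (i < k)%N & v = iter i f c.
  by exists (findex f c v); rewrite ?findex_max ?iter_findex.
have m'i : m' (iter i f c) = iter (k - i) f c by rewrite m_f // ltnW.
have mi : m (iter i f c) = iter (k - i).+1 f c.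
  by rewrite /= -m'i /f m'K.
rewrite m'i mi; split; try exact: fconnect_iter.
have eq_iter a b : (a < k)%N -> (b < k)%N ->
    (iter a f c == iter b f c) = (a == b).
  move=> lt_a lt_b; apply/eqP/eqP=> [|->//] /(congr1 (findex f c)).
  by rewrite !findex_iter.
have red a : (k <= a)%N -> iter a f c = iter (a - k) f c.
  by move=> le_ka; rewrite -{1}(subnK le_ka) iterD fkc.
have eq_iter_c a : (a < k)%N -> (iter a f c == c) = (a == 0)%N.
  by move=> lt_a; rewrite -(eq_iter a 0%N).
have lt_uk : (uphalf k < k)%N || (k == 1)%N by lia.
have [i0|i_gt0] := posnP i.
  rewrite {}i0 subn0 red // subSnn fkc [iter 0 f c]/= eqxx.
  have [k1|k_neq1] := eqVneq k 1%N.
    by move: fkc; rewrite k1 /= => ->; rewrite eqxx.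
  by rewrite (eq_sym c) !eq_iter_c; lia.
have [i1|i_neq1] := eqVneq i 1%N; last by rewrite eq_iter_c // !eq_iter; lia.
rewrite i1 subn1 prednK // fkc (eq_sym c) eq_iter_c; last by lia.
by rewrite !eq_iter; lia.
Qed.

End Dihedral.

Section Matching.

Variable T : finType.
Implicit Types (M : {set {set T}}) (u v w : T) (K : {set T}).

Definition deg M v := #|[set e in M | v \in e]|.

Definition matching M := simple_graph M /\ forall v, (deg M v <= 1)%N.

Definition mate M v := odflt v [pick u | [set v; u] \in M].

Lemma mate_unique M v u : matching M -> [set v; u] \in M -> mate M v = u.
Proof.
move=> [simM degM] vu; rewrite /mate; case: pickP => [w vw|/(_ u)]; last by rewrite vu.
apply: (@set2_inj _ v); apply/eqP/negPn/negP=> neq.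
have := degM v; rewrite leqNgt => /negP[].
apply: leq_trans (subset_leq_card (_ : [set [set v; w]; [set v; u]] \subset _)).
  by rewrite cards2 neq.
by apply/subsetP=> e /set2P[]->; rewrite inE ?vu ?vw set21.
Qed.

Lemma mate_fix M v : matching M -> (mate M v == v) = (deg M v == 0%N).
Proof.
move=> [simM degM]; rewrite /mate; case: pickP => [u vu|no_u] /=.
  rewrite eq_sym (negPf (adj_neq simM vu)); apply/esym/negbTE; rewrite -lt0n.
  by apply/card_gt0P; exists [set v; u]; rewrite inE vu set21.
rewrite eqxx; apply/esym; rewrite cards_eq0; apply/eqP/setP=> e; rewrite !inE.
apply/negP=> /andP[Me ve]; have [u vu _] := edge_other simM Me ve.
by rewrite /adj no_u in vu.
Qed.

Lemma mateK M : matching M -> involutive (mate M).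
Proof.
move=> mM v; have [/eqP mv|neq] := boolP (mate M v == v); first by rewrite !mv.
apply: mate_unique => //; move: neq; rewrite /mate.
by case: pickP => [u vu _|]; rewrite ?eqxx //= setUC.
Qed.

Lemma mate_edge M v : matching M -> mate M v != v -> [set v; mate M v] \in M.
Proof. by move=> mM; rewrite /mate; case: pickP => //= _; rewrite eqxx. Qed.

Definition component M v := [set w | connect (fun x y => [set x; y] \in M) v w].

Lemma component_edge M v x y :
  [set x; y] \in M -> (x \in component M v) = (y \in component M v).
Proof.
have sym : connect_sym (fun x y => [set x; y] \in M).
  by apply: sym_connect_sym => a b; rewrite setUC.
by move=> xy; rewrite !inE; apply: same_connect_r => //; apply: connect1.
Qed.

Lemma component_refl M v : v \in component M v.
Proof. by rewrite inE connect0. Qed.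

Lemma component_sub M v w : w \in component M v -> component M w = component M v.
Proof.
have sym : connect_sym (fun x y => [set x; y] \in M).
  by apply: sym_connect_sym => a b; rewrite setUC.
by rewrite inE => vw; apply/setP=> x; rewrite !inE (same_connect sym vw).
Qed.

Lemma alternating_component M M' c :
    matching M -> matching M' -> deg M c != deg M' c ->
  exists d, [/\ d != c, d \in component (M :|: M') c &
    forall v, v \in component (M :|: M') c ->
      (deg M v != deg M' v) = (v == c) || (v == d)].
Proof.
wlog M'c : M M' / deg M' c = 0%N => [hw mM mM' neq|].
  have [M'c|M'c] := eqVneq (deg M' c) 0%N; first exact: hw.
  have Mc : deg M c = 0%N.
    by case: (mM) (mM') => [_ /(_ c)] + [_ /(_ c)]; lia.
  have [|d [dc cd dP]] := hw M' M Mc mM' mM; first by rewrite eq_sym.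
  by exists d; rewrite setUC; split=> // v /dP <-; rewrite eq_sym.
move=> mM mM'; rewrite M'c => Mc.
have m'c : mate M' c = c by apply/eqP; rewrite mate_fix // M'c.
have [d cd dP] := dihedral_orbit (mateK mM) (mateK mM') m'c.
have deg_le v : (deg M v <= 1)%N && (deg M' v <= 1)%N.
  by case: mM mM' => _ -> [_ ->].
have dc : d != c.
  have [_ _] := dP c (connect0 _ _).
  rewrite !mate_fix // eqxx M'c (eq_sym c) (negPf Mc).
  by case: (d == c).
set C := component _ c.
have C_mate L v : matching L -> L \subset M :|: M' -> (mate L v \in C) = (v \in C).
  move=> mL /subsetP sL; have [->//|/(mate_edge mL)/sL] := eqVneq (mate L v) v.
  by move/component_edge->.
exists d; split=> // [|v].
  rewrite -(@fconnect_invariant _ _ _ (fun v => v \in C) _ c d cd) ?component_refl //.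
  by move=> v; rewrite /= !C_mate ?subsetUl ?subsetUr ?eqxx.
rewrite inE => cv.
suff /dP[_ _] : fconnect (fun x => mate M (mate M' x)) c v.
  have : ~~ ((v == c) && (v == d)).
    by apply: contra dc => /andP[/eqP<- /eqP<-].
  by rewrite !mate_fix //; have := deg_le v; lia.
case/connectP: cv => p p_path ->.
elim/last_ind: p p_path => [|p x IHp] /=; first by rewrite connect0.
rewrite rcons_path last_rcons => /andP[/IHp/dP[cm cm' _]].
rewrite inE => /orP[/(mate_unique mM)<-|/(mate_unique mM')<-] //.
Qed.

Definition swap K M M' := [set e in M | ~~ (e \subset K)] :|: [set e in M' | e \subset K].

Definition saturated M K := forall x y, [set x; y] \in M -> (x \in K) = (y \in K).

Lemma saturated_sub M K e v : simple_graph M -> saturated M K ->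
  e \in M -> v \in e -> (e \subset K) = (v \in K).
Proof.
move=> simM satK Me ve; have [w vw eE] := edge_other simM Me ve.
by rewrite eE subUset !sub1set (satK _ _ vw) andbb.
Qed.

Lemma deg_swap M M' K v :
    simple_graph M -> simple_graph M' -> saturated M K -> saturated M' K ->
  deg (swap K M M') v = if v \in K then deg M' v else deg M v.
Proof.
move=> simM simM' satM satM'.
case: ifPn => vK; apply: eq_card => e; rewrite !inE;
  case: (boolP (v \in e)) => ve; rewrite ?andbF // !andbT.
- have [Me|] := boolP (e \in M); have [M'e|_] := boolP (e \in M'); rewrite ?orbF //=;
    rewrite ?(saturated_sub simM satM Me ve) ?(saturated_sub simM' satM' M'e ve) vK //.
- have [Me|] := boolP (e \in M); have [M'e|_] := boolP (e \in M'); rewrite ?orbF //=;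
    rewrite ?(saturated_sub simM satM Me ve) ?(saturated_sub simM' satM' M'e ve) (negPf vK) //.
Qed.

Lemma swapK M M' K : swap K (swap K M M') (swap K M' M) = M.
Proof.
apply/setP=> e; rewrite !inE.
by case: (e \in M); case: (e \in M'); case: (e \subset K).
Qed.

Lemma swapU M M' K : swap K M M' :|: swap K M' M = M :|: M'.
Proof.
apply/setP=> e; rewrite !inE.
by case: (e \in M); case: (e \in M'); case: (e \subset K).
Qed.

Lemma prod_swap (R : comNzRingType) (h : {set T} -> R) M M' K :
  (\prod_(e in swap K M M') h e) * (\prod_(e in swap K M' M) h e)
  = (\prod_(e in M) h e) * (\prod_(e in M') h e).
Proof.
have mk (A : {set {set T}}) : \prod_(e in A) h e = \prod_e (if e \in A then h e else 1).
  exact: big_mkcond.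
rewrite !mk -!big_split /=; apply: eq_bigr => e _; rewrite !inE.
by case: (e \in M); case: (e \in M'); case: (e \subset K); rewrite ?mulr1 ?mul1r // mulrC.
Qed.

Lemma sum_deg_saturated M (W : {set T}) : simple_graph M -> saturated M W ->
  \sum_(v in W) odd (deg M v) = 0 :> bool.
Proof.
move=> simM satW.
under eq_bigr => v _.
  rewrite (_ : odd _ = \sum_(e in M) (v \in e)); last first.
    by rewrite sum_bool_odd; congr odd; apply: eq_card => e; rewrite !inE.
  over.
rewrite exchange_big big1 //= => e Me; rewrite sum_bool_odd.
have eW z : z \in e -> (z \in W) = (e \subset W).
  by move=> ze; rewrite (saturated_sub simM satW Me ze).
have [sub_eW|nsub_eW] := boolP (e \subset W).
  rewrite (_ : #|_| = #|e|); first by rewrite simM.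
  apply: eq_card => z; rewrite !inE.
  by case: (boolP (z \in e)) => ze; rewrite ?andbF // eW // sub_eW.
rewrite (_ : #|_| = 0%N) //; apply: eq_card0 => z; rewrite !inE.
by apply/negP=> /andP[zW ze]; rewrite -(eW z) // zW in nsub_eW.
Qed.

End Matching.

Lemma pm_deg (T : finType) (M : {set {set T}}) (Z : {set T}) : simple_graph M ->
  partition M (~: Z) = [forall v, deg M v == (v \notin Z)].
Proof.
move=> simM; apply/idP/forallP=> [/and3P[/eqP covM trivM no0] v|degM].
  have [vZ|vZ] := boolP (v \in Z).
    rewrite cards_eq0; apply/eqP/setP=> e; rewrite !inE.
    apply/negP=> /andP[Me ve]; have : v \in cover M by apply/bigcupP; exists e.
    by rewrite covM inE vZ.
  have vM : v \in cover M by rewrite covM inE.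
  rewrite /deg (_ : [set e in M | v \in e] = [set pblock M v]) ?cards1 //.
  apply/setP=> e; rewrite !inE; apply/andP/eqP=> [[Me ve]|->].
    by rewrite (def_pblock trivM Me ve).
  by rewrite pblock_mem // mem_pblock.
have mem1 e v : e \in M -> v \in e -> v \notin Z.
  move=> Me ve; suff: (0 < (v \notin Z))%N by rewrite lt0b.
  rewrite -(eqP (degM v)) /deg.
  by apply/card_gt0P; exists e; rewrite inE Me.
apply/and3P; split.
- apply/eqP/setP=> v; rewrite inE; apply/bigcupP/idP=> [[e Me]|vZ]; first exact: mem1.
  have: (0 < deg M v)%N by rewrite (eqP (degM v)) vZ.
  by rewrite /deg; case/card_gt0P=> e; rewrite inE => /andP[]; exists e.
- apply/trivIsetP=> e e' Me Me' neq; rewrite -setI_eq0; apply/eqP/setP=> v.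
  rewrite !inE; apply/negP=> /andP[ve ve'].
  have := eqP (degM v); rewrite (mem1 e v) // => deg1.
  have : (#|[set e; e']| <= deg M v)%N.
    apply: subset_leq_card; apply/subsetP=> x /set2P[]->; rewrite inE.
      by rewrite Me.
    by rewrite Me'.
  by rewrite cards2 neq deg1.
- by apply/negP=> /simM; rewrite cards0.
Qed.

Lemma sub_simple (T : finType) (M E : {set {set T}}) :
  simple_graph E -> M \subset E -> simple_graph M.
Proof. by move=> simE /subsetP sME e /sME/simE. Qed.

(** * Disjoint paths between external nodes do not cross *)

Section AddInfinity.

Variables (V : finType) (E : {set {set V}}) (N : nat) (x : 'I_N -> V).
Hypotheses (simE : simple_graph E) (inj_x : injective x).

Definition lift_edge (e : {set V}) : {set option V} := [set Some u | u in e].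
Definition spoke (v : V) : {set option V} := [set None; Some v].

Lemma lift_edge_inj : injective lift_edge.
Proof. by apply: imset_inj => u v []. Qed.

Lemma lift_edge2 u v : lift_edge [set u; v] = [set Some u; Some v].
Proof. by rewrite /lift_edge imsetU1 imset_set1. Qed.

Lemma mem_lift_edge v e : (Some v \in lift_edge e) = (v \in e).
Proof. by rewrite mem_imset // => u w []. Qed.

Lemma None_lift_edge e : (None \in lift_edge e) = false.
Proof. by apply/imsetP=> [[]]. Qed.

Lemma spoke_inj : injective spoke.
Proof. by move=> u v /set2_inj[]. Qed.

Lemma mem_spoke u v : (Some u \in spoke v) = (u == v).
Proof. by rewrite !inE. Qed.

Lemma add_infinityE :
  add_infinity E x = [set lift_edge e | e in E] :|: [set spoke (x i) | i : 'I_N].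
Proof. by []. Qed.

Lemma adj_infinity_Some u v : adj (add_infinity E x) (Some u) (Some v) = adj E u v.
Proof.
rewrite /adj add_infinityE inE -lift_edge2 (mem_imset _ _ lift_edge_inj).
case: (_ \in E) => //=; apply/imsetP=> [[i _ /setP/(_ None)]].
by rewrite None_lift_edge !inE.
Qed.

Lemma adj_infinity_None v : adj (add_infinity E x) None (Some v) = (v \in codom x).
Proof.
rewrite /adj add_infinityE inE; apply/orP/codomP=> [[]|[i ->]].
- by case/imsetP=> e _ /setP/(_ None); rewrite None_lift_edge !inE eqxx.
- by case/imsetP=> i _ /spoke_inj->; exists i.
by right; apply: imset_f.
Qed.

Lemma adj_infinity_None2 : adj (add_infinity E x) None None = false.
Proof.
rewrite /adj add_infinityE inE setUid; apply/orP=> [[]] /imsetP[e _].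
  by move/setP/(_ None); rewrite None_lift_edge !inE eqxx.
by move/setP/(_ (Some (x e))); rewrite !inE eqxx.
Qed.

Lemma simple_add_infinity : simple_graph (add_infinity E x).
Proof.
move=> e /setUP[]/imsetP[e' Ee ->]; last by rewrite cards2.
by rewrite card_imset ?simE // => u v [].
Qed.

Lemma sum_add_infinity (A : nmodType) (P : pred {set option V}) (g : {set option V} -> A) :
  \sum_(e in add_infinity E x | P e) g e
  = \sum_(e in E | P (lift_edge e)) g (lift_edge e)
    + \sum_(i | P (spoke (x i))) g (spoke (x i)).
Proof.
have mk (B : {set {set option V}}) :
    \sum_(e in B | P e) g e = \sum_(e in B) (if P e then g e else 0).
  by rewrite big_mkcondr.
set B1 := [set lift_edge e | e in E]; set B2 := [set spoke (x i) | i : 'I_N].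
rewrite mk (eq_bigl [in [predU B1 & B2]]) => [|e]; last by rewrite !inE.
rewrite bigU /=; last first.
  rewrite -setI_eq0; apply/eqP/setP=> e; rewrite !inE; apply/negP=> /andP[].
  case/imsetP=> e1 _ -> /imsetP[i _ /setP/(_ None)].
  by rewrite None_lift_edge !inE.
rewrite /B1 /B2 !big_imset /= ?big_mkcondr //; last by move=> e e' _ _ /lift_edge_inj.
  by congr (_ + _); rewrite [RHS]big_mkcond; apply: eq_bigl.
by move=> i j _ _ /spoke_inj/inj_x.
Qed.

End AddInfinity.

Section NonCrossing.

Variables (V : finType) (E : {set {set V}}) (N : nat) (x : 'I_N -> V).
Variable r : option V -> {perm option V}.
Let Einf := add_infinity E x.
Hypotheses (simE : simple_graph E) (inj_x : injective x).
Hypotheses (rotr : rotation_system Einf r)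
  (r_inf : forall i, r None (Some (x i)) = Some (x (ordS i)))
  (all_bd : forall c, chain_cycle Einf c -> chain_boundary Einf r c).
Variables (M M' : {set {set V}}) (D : pred 'I_N) (p q : 'I_N) (K : {set V}).
Hypotheses (sME : M \subset E) (sM'E : M' \subset E).
Hypotheses (matM : matching M) (matM' : matching M').
Hypothesis degD : forall v, (deg M v != deg M' v) = [exists i, D i && (x i == v)].
Hypotheses (neq_pq : p != q) (Dp : D p) (Dq : D q).
Hypotheses (satM : saturated M K) (satM' : saturated M' K).
Hypothesis KD : forall i, D i -> (x i \in K) = (i == p) || (i == q).

(* The alternating path K closed up through the point at infinity. *)
Let c (e : {set option V}) :=
  if None \in e then (e == spoke (x p)) || (e == spoke (x q))
  else let e0 := [set v | Some v \in e] in
       (e0 \subset K) && ((e0 \in M) (+) (e0 \in M')).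

Let c_spoke v : c (spoke v) = (v == x p) || (v == x q).
Proof. by rewrite /c set21 !(inj_eq (@spoke_inj V)). Qed.

Let c_lift e : c (lift_edge e) = (e \subset K) && ((e \in M) (+) (e \in M')).
Proof.
rewrite /c None_lift_edge (_ : [set v | _] = e) //.
by apply/setP=> v; rewrite inE mem_lift_edge.
Qed.

Let odd_deg (L : {set {set V}}) v : L \subset E ->
  \sum_(e in E | v \in e) (e \in L) = odd (deg L v) :> bool.
Proof.
move/subsetP=> sLE; rewrite sum_bool_odd; congr odd; apply: eq_card => e; rewrite !inE.
by case: (boolP (e \in L)) => [/sLE->|_]; rewrite ?andbF ?andbT.
Qed.

Let odd_degD v : odd (deg M v) (+) odd (deg M' v) = [exists i, D i && (x i == v)].
Proof. by rewrite -degD; case: matM matM' => [_ /(_ v)] + [_ /(_ v)]; lia. Qed.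

Let c_cycle : chain_cycle Einf c.
Proof.
move=> [v|]; rewrite sum_add_infinity //; last first.
  rewrite big_pred0 => [|e]; last by rewrite None_lift_edge andbF.
  rewrite add0r (bigD1 p) ?set21 //= (bigD1 q) /=; last by rewrite set21 eq_sym.
  rewrite !c_spoke !eqxx orbT big1 //= => i /andP[/andP[_ ip] iq].
  by rewrite c_spoke !(inj_eq inj_x) (negPf ip) (negPf iq).
have -> : \sum_(e in E | Some v \in lift_edge e) c (lift_edge e)
    = (v \in K) && [exists i, D i && (x i == v)] :> bool.
  rewrite -odd_degD -(odd_deg v sME) -(odd_deg v sM'E).
  transitivity (\sum_(e in E | v \in e) (v \in K) * ((e \in M) + (e \in M')) : bool).
    apply: eq_big => [e|e /andP[Ee]]; first by rewrite mem_lift_edge.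
    rewrite mem_lift_edge c_lift => ve.
    have [Me|nMe] := boolP (e \in M).
      by rewrite (saturated_sub (sub_simple simE sME) satM Me ve).
    have [Me|nMe'] := boolP (e \in M'); last by rewrite andbF mulr0.
    by rewrite (saturated_sub (sub_simple simE sM'E) satM' Me ve).
  by rewrite -mulr_sumr big_split.
have [/codomP[i ->]|v_notin] := boolP (v \in codom x).
  rewrite (big_pred1 i) => [|j]; last by rewrite mem_spoke (inj_eq inj_x) eq_sym.
  rewrite c_spoke !(inj_eq inj_x).
  have -> : [exists j, D j && (x j == x i)] = D i.
    apply/existsP/idP=> [[j /andP[Dj /eqP/inj_x<-]] //|Di].
    by exists i; rewrite Di eqxx.
  have [Di|nDi] := boolP (D i); first by rewrite KD // andbT; case: (_ || _).
  have [ip|] := eqVneq i p; first by rewrite ip Dp in nDi.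
  have [iq|] := eqVneq i q; first by rewrite iq Dq in nDi.
  by rewrite andbF.
rewrite big_pred0 => [|i]; last first.
  by rewrite mem_spoke; apply: contraNF v_notin => /eqP->; apply: codom_f.
rewrite addr0; apply/negbTE/andP=> [[_ /existsP[i /andP[_ /eqP xi]]]].
by case/negP: v_notin; rewrite -xi codom_f.
Qed.

Let i0 : 'I_N := Ordinal (leq_ltn_trans (leq0n p) (ltn_ord p)).

(* f is a colouring of the faces on the two sides of the closed path.  Its value
   is constant around a node v off the path; W is the set of such v coloured
   differently from the corner at the spoke i0, and W is a union of matching edges for
   both M and M'. *)
Lemma noncrossing :
  odd #|[pred i | D i && (i < p)%N]| != odd #|[pred i | D i && (i < q)%N]|.
Proof.
have [f f_face f_bd] := all_bd c_cycle.
have inf_adj i : adj Einf None (Some (x i)) by rewrite adj_infinity_None codom_f.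
pose t i := f None (Some (x i)).
have t_ext i : f (Some (x i)) None = t i + ((i == p) || (i == q)).
  have := f_bd None (Some (x i)) (inf_adj i).
  rewrite -/(spoke (x i)) c_spoke !(inj_eq inj_x) -/(t i) => <-.
  by case: (t i); case: (f _ _).
have t_step i : t (ordS i) = t i + ((i == p) || (i == q)).
  by rewrite -t_ext -f_face 1?adj_sym // r_inf.
have t_val (i : 'I_N) : t i = t i0 + (p < i)%N + (q < i)%N.
  case: i => k; elim: k => [|k IHk] lt_k.
    by rewrite !addr0; congr t; apply: val_inj.
  have lt_k' := ltnW lt_k; have -> : Ordinal lt_k = ordS (Ordinal lt_k').
    by apply: val_inj; rewrite /= modn_small.
  rewrite t_step IHk /= -!val_eqE /= modn_small // !ltnS.
  move: neq_pq; rewrite -val_eqE /=.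
  by case: (t i0); case: (ltngtP p k); case: (ltngtP q k) => //= -> ->; rewrite eqxx.
have c0 v u : v \notin K -> adj Einf (Some v) u -> c [set u; Some v] = 0.
  move=> vK; case: u => [w|] vu.
    by rewrite -lift_edge2 c_lift subUset !sub1set (negPf vK) andbF.
  rewrite -/(spoke v) c_spoke; apply: contraNF vK.
  by case/orP=> /eqP->; rewrite KD ?eqxx ?orbT.
have f_sym v u : v \notin K -> adj Einf (Some v) u -> f u (Some v) = f (Some v) u.
  move=> vK vu; have := f_bd u (Some v); rewrite adj_sym => /(_ vu).
  by rewrite c0 //; case: (f _ _); case: (f _ _).
have f_const v u u' : v \notin K -> adj Einf (Some v) u -> adj Einf (Some v) u' ->
    f (Some v) u = f (Some v) u'.
  move=> vK vu vu'; have : u' \in porbit (r (Some v)) u by rewrite (rotr vu) inE.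
  case/porbitP=> k ->; elim: k {vu'} => [|k IHk]; first by rewrite perm1.
  have vk : adj Einf (Some v) ((r (Some v) ^+ k)%g u).
    by have := mem_porbit (r (Some v)) k u; rewrite (rotr vu) inE.
  by rewrite expgSr permM f_face 1?adj_sym // f_sym.
pose W := [set v | (v \notin K) &&
  [exists u, adj Einf (Some v) u && (f (Some v) u (+) t i0)]].
have WE v u : v \notin K -> adj Einf (Some v) u -> (v \in W) = f (Some v) u (+) t i0.
  move=> vK vu; rewrite inE vK; apply/existsP/idP => [[u' /andP[vu']]|].
    by rewrite (f_const v u' u).
  by exists u; rewrite vu.
have satW (L : {set {set V}}) : L \subset E -> saturated L K -> saturated L W.
  move=> /subsetP sLE satL v w Lvw; have Kvw := satL v w Lvw.
  have vw : adj Einf (Some v) (Some w) by rewrite adj_infinity_Some; apply: sLE.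
  have [vK|vK] := boolP (v \in K); first by rewrite !inE -Kvw vK.
  have wv : adj Einf (Some w) (Some v) by rewrite adj_sym.
  have wK : w \notin K by rewrite -Kvw.
  by rewrite (WE v (Some w)) // (WE w (Some v)) // (f_sym w (Some v)).
have sumW : \sum_(i | D i) (x i \in W) = 0 :> bool.
  rewrite sum_bool_odd -(card_image inj_x); set A := image _ _.
  transitivity (\sum_(v in W) [exists i, D i && (x i == v)] : bool).
    rewrite sum_bool_odd; congr odd; apply: eq_card => v; rewrite [RHS]inE.
    apply/imageP/andP=> [[i /andP[Di Wi] ->]|[Wv /existsP[i /andP[Di /eqP xi]]]].
      by split=> //; apply/existsP; exists i; rewrite Di eqxx.
    by exists i; rewrite // -topredE /= Di xi.
  under eq_bigr do rewrite -odd_degD.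
  rewrite big_split /= !sum_deg_saturated ?addr0 //; do ?exact: satW.
  - exact: sub_simple sM'E.
  - exact: sub_simple sME.
have : \sum_(i | D i) ((i < p)%N + (i < q)%N) = 1 :> bool.
  transitivity (\sum_(i | D i) ((x i \in W)
      + (((i == p) && (p < q)%N) + ((i == q) && (q < p)%N))) : bool).
    apply: eq_bigr => i Di; have := KD Di.
    have [xK|xK] := boolP (x i \in K) => /esym.
      rewrite (_ : x i \in W = false); last by rewrite inE xK.
      case/orP=> /eqP->; rewrite eqxx ltnn.
        by rewrite (negPf neq_pq); case: (p < q)%N.
      by rewrite eq_sym (negPf neq_pq); case: (q < p)%N.
    case/norP=> ip iq; rewrite (WE _ None) // 1?adj_sym //.
    rewrite t_ext (negPf ip) (negPf iq) t_val.
    move: ip iq; rewrite -!val_eqE.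
    by case: (t i0); case: (ltngtP p i); case: (ltngtP q i).
  rewrite big_split /= sumW add0r big_split /=.
  rewrite (bigD1 p) //= eqxx big1 => [|i /andP[_ /negPf->]] //.
  rewrite (bigD1 q) //= eqxx big1 => [|i /andP[_ /negPf->]] //.
  by move: neq_pq; rewrite -val_eqE; case: ltngtP.
rewrite big_split /= !sum_bool_odd.
by case: (odd _); case: (odd _).
Qed.

End NonCrossing.

(** * The matchgate identities *)

(* Bit strings form a vector space over F_2 = bool; bit flips are additions. *)
Definition bits (N : nat) := {ffun 'I_N -> bool}.
Definition unit_bit (N : nat) (p : 'I_N) : bits N := [ffun q => q == p].

Section MatchgateIdentity.

Variables (F : fieldType) (N : nat) (G : matchgate F N).
Implicit Types (X Y : bits N) (M : {set {set node G}}).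

Definition sig X := perf_match [set ext G i | i : 'I_N & X i].

Definition pm X M := (M \subset edges G) &&
  [forall v, deg M v == ~~ [exists i, X i && (ext G i == v)]].

Lemma edges_simple : simple_graph (edges G).
Proof. exact: edges_card2. Qed.

Lemma mem_removed X v :
  (v \in [set ext G i | i : 'I_N & X i]) = [exists i, X i && (ext G i == v)].
Proof.
apply/imsetP/existsP=> [[i + ->]|[i /andP[Xi /eqP<-]]].
  by rewrite inE => Xi; exists i; rewrite Xi eqxx.
by exists i; rewrite ?inE.
Qed.

Lemma sigE X : sig X = \sum_(M | pm X M) \prod_(e in M) weight e.
Proof.
apply: eq_bigl => M; rewrite /pm; case: (boolP (M \subset _)) => //= sME.
rewrite pm_deg; last exact: sub_simple edges_simple sME.
by apply: eq_forallb => v; rewrite mem_removed.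
Qed.

Lemma pm_ext X M i : pm X M -> deg M (ext G i) = ~~ X i.
Proof.
case/andP=> _ /forallP/(_ (ext G i))/eqP->; congr (~~ _ : nat).
apply/existsP/idP=> [[j /andP[Xj /eqP/ext_inj<-]]|Xi] //.
by exists i; rewrite Xi eqxx.
Qed.

Lemma pm_int X M v : pm X M -> v \notin codom (ext G) -> deg M v = 1%N.
Proof.
case/andP=> _ /forallP/(_ v)/eqP-> v_int; rewrite (_ : [exists _, _] = false) //.
by apply: contraNF v_int => /existsP[i /andP[_ /eqP<-]]; apply: codom_f.
Qed.

Lemma pmI X M : M \subset edges G ->
    (forall i, deg M (ext G i) = ~~ X i) ->
    (forall v, v \notin codom (ext G) -> deg M v = 1%N) ->
  pm X M.
Proof.
move=> sME degX deg1; rewrite /pm sME; apply/forallP=> v.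
have [/codomP[i ->]|v_int] := boolP (v \in codom (ext G)).
  rewrite degX; apply/eqP; congr (~~ _ : nat).
  apply/idP/existsP=> [Xi|[j /andP[Xj /eqP/ext_inj<-]]] //.
  by exists i; rewrite Xi eqxx.
rewrite deg1 //; apply/eqP; rewrite (_ : [exists _, _] = false) //.
by apply: contraNF v_int => /existsP[i /andP[_ /eqP<-]]; apply: codom_f.
Qed.

Lemma pm_matching X M : pm X M -> matching M.
Proof.
case/andP=> sME /forallP degM; split; first exact: sub_simple edges_simple sME.
by move=> v; rewrite (eqP (degM v)) leq_b1.
Qed.

Lemma sig_parity X : sig X != 0 -> odd #|[pred i | X i]| = odd #|node G|.
Proof.
apply: contraNeq => parX; rewrite sigE big_pred0 // => M; apply/negP=> pmM.
case/negP: parX; have [simM _] := pm_matching pmM.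
have := @sum_deg_saturated _ M [set: node G] simM.
have satT : saturated M [set: node G] by move=> x y _; rewrite !inE.
move/(_ satT); rewrite sum_bool_odd => /negbT even_rest; apply/eqP.
set A := [set ext G i | i : 'I_N & X i].
have -> : #|[pred i | X i]| = #|A|.
  rewrite card_imset; last exact: ext_inj.
  by apply: eq_card => i; rewrite !inE.
rewrite -(cardC A) oddD (_ : odd #|[predC _]| = false) ?addbF //.
apply: contraNF even_rest; congr odd; apply: eq_card => v; rewrite !inE /=.
rewrite mem_removed.
by case/andP: pmM => _ /forallP/(_ v)/eqP->; case: [exists i, _].
Qed.

Definition diff X Y : pred 'I_N := fun i => X i != Y i.
Definition sgn_before X Y (p : 'I_N) : F :=
  (-1) ^+ #|[pred i | diff X Y i && (i < p)%N]|.

Section Superposition.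

Variables (X Y : bits N).
Let D := diff X Y.

Let comp (p : 'I_N) M M' := component (M :|: M') (ext G p).
Let partner p M M' := odflt p [pick q | [&& q != p, D q & ext G q \in comp p M M']].

Let good (t : 'I_N * ({set {set node G}} * {set {set node G}})) :=
  [&& D t.1, pm (X + unit_bit t.1) t.2.1 & pm (Y + unit_bit t.1) t.2.2].

Let flip t : 'I_N * ({set {set node G}} * {set {set node G}}) :=
  let K := comp t.1 t.2.1 t.2.2 in
  (partner t.1 t.2.1 t.2.2, (swap K t.2.1 t.2.2, swap K t.2.2 t.2.1)).

Let degDi p M M' i : pm (X + unit_bit p) M -> pm (Y + unit_bit p) M' ->
  (deg M (ext G i) != deg M' (ext G i)) = D i.
Proof.
move=> pmM pmM'; rewrite (pm_ext _ pmM) (pm_ext _ pmM') !ffunE /D /diff.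
by case: (X i); case: (Y i); case: (i == p).
Qed.

Let partnerP p M M' (q := partner p M M') : good (p, (M, M')) ->
  [/\ q != p, D q & forall i, D i ->
       (ext G i \in comp p M M') = (i == p) || (i == q)].
Proof.
case/and3P=> /= Dp pmM pmM'.
have matM := pm_matching pmM; have matM' := pm_matching pmM'.
have degD i := degDi i pmM pmM'.
have [|d [dc dK dP]] := alternating_component matM matM' (c := ext G p).
  by rewrite degD.
have [j Dj extj] : exists2 j, D j & ext G j = d.
  have := dP d dK; rewrite eqxx orbT.
  have [/codomP[j ->]|d_int] := boolP (d \in codom (ext G)).
    by rewrite degD => Dj; exists j.
  by rewrite (pm_int pmM d_int) (pm_int pmM' d_int).
have memD i : D i -> (ext G i \in comp p M M') = (i == p) || (i == j).
  move=> Di; apply/idP/idP=> [/dP|].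
    by rewrite degD Di -extj !(inj_eq (@ext_inj _ _ G)) => /esym.
  by case/orP=> /eqP->; rewrite ?extj // component_refl.
have jp : j != p by rewrite -(inj_eq (@ext_inj _ _ G)) extj.
suff -> : q = j by [].
rewrite /q /partner; case: pickP => [i /and3P[ip Di]|/(_ j)] /=.
  by rewrite memD // (negPf ip) => /eqP.
by rewrite jp Dj memD // eqxx orbT.
Qed.

Let flip_good t : good t -> good (flip t).
Proof.
case: t => p [M M'] gt; have [qp Dq memD] := partnerP gt.
case/and3P: (gt) => /= Dp pmM pmM'.
have matM := pm_matching pmM; have matM' := pm_matching pmM'.
set K := comp p M M'; set q := partner p M M' in qp Dq memD *.
have satM : saturated M K.
  by move=> u v uv; apply: component_edge; rewrite inE uv.
have satM' : saturated M' K.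
  by move=> u v uv; apply: component_edge; rewrite inE uv orbT.
have deg1 := deg_swap _ matM.1 matM'.1 satM satM'.
have deg2 := deg_swap _ matM'.1 matM.1 satM' satM.
have sub_swap (L L' : {set {set node G}}) : L \subset edges G -> L' \subset edges G ->
    swap K L L' \subset edges G.
  move=> /subsetP sL /subsetP sL'; apply/subsetP=> e; rewrite !inE.
  by case/orP=> /andP[]; [move/sL|move/sL'].
have [sM sM'] : M \subset edges G /\ M' \subset edges G.
  by case/andP: pmM => -> _; case/andP: pmM'.
have pK : ext G p \in K := component_refl _ _.
have qK : ext G q \in K by rewrite memD // eqxx orbT.
have bitK i : ext G i \in K -> (X + unit_bit q) i = (Y + unit_bit p) i
                             /\ (Y + unit_bit q) i = (X + unit_bit p) i.
  rewrite !ffunE => iK; have [Di|] := boolP (D i).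
    move: (memD i Di) (Di); rewrite iK /D /diff.
    have [->|_] := eqVneq i p; first by rewrite eq_sym (negPf qp); case: (X p); case: (Y p).
    by move=> /= <-; case: (X i); case: (Y i).
  move=> nDi; have Xi : X i = Y i by apply/eqP; rewrite -[_ == _]negbK.
  have [ip|_] := eqVneq i p; first by rewrite ip Dp in nDi.
  by have [iq|_] := eqVneq i q; [rewrite iq Dq in nDi|rewrite Xi].
have bit_notK i : ext G i \notin K -> (X + unit_bit q) i = (X + unit_bit p) i
                                   /\ (Y + unit_bit q) i = (Y + unit_bit p) i.
  move=> iK; rewrite !ffunE; have [ip|_] := eqVneq i p; first by rewrite ip pK in iK.
  by have [iq|_] := eqVneq i q; first by rewrite iq qK in iK.
apply/and3P; split=> //=; apply: pmI => [|i|v v_int]; rewrite ?sub_swap ?deg1 ?deg2 //.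
- by case: ifPn => [/bitK|/bit_notK] [-> _]; apply: pm_ext.
- by rewrite (pm_int pmM) // (pm_int pmM') //; case: ifP.
- by case: ifPn => [/bitK|/bit_notK] [_ ->]; apply: pm_ext.
- by rewrite (pm_int pmM) // (pm_int pmM') //; case: ifP.
Qed.

Let flipK t : good t -> flip (flip t) = t.
Proof.
case: t => p [M M'] gt; have [qp Dq memD] := partnerP gt.
have gft := flip_good gt; have [qp' Dq' memD'] := partnerP gft.
move: qp' Dq' memD'; rewrite /flip /=; set K := comp p M M' in memD *.
set q := partner p M M' in qp Dq memD *.
have -> : comp q (swap K M M') (swap K M' M) = K.
  rewrite /comp swapU; apply: component_sub.
  by rewrite memD // eqxx orbT.
rewrite !swapK => qp' Dq'; set q' := partner _ _ _ in qp' Dq' *.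
move/(_ q' Dq'); rewrite eqxx orbT memD // => /orP[/eqP->//|/eqP q'q].
by rewrite q'q eqxx in qp'.
Qed.

Hypothesis char_not2 : (2%:R : F) != 0.

Lemma matchgate_identity :
  \sum_(p | D p) sgn_before X Y p * (sig (X + unit_bit p) * sig (Y + unit_bit p)) = 0.
Proof.
pose w M := \prod_(e in M) weight e : F.
pose h (t : 'I_N * ({set {set node G}} * {set {set node G}})) :=
  sgn_before X Y t.1 * (w t.2.1 * w t.2.2).
have -> : \sum_(p | D p) sgn_before X Y p * (sig (X + unit_bit p) * sig (Y + unit_bit p))
    = \sum_(t | good t) h t.
  rewrite (eq_bigr (fun p => \sum_(u | pm (X + unit_bit p) u.1 && pm (Y + unit_bit p) u.2)
                              h (p, u))) => [|p Dp].
    by rewrite pair_big_dep.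
  by rewrite !sigE big_distrlr pair_big /= mulr_sumr.
have eq_opp : \sum_(t | good t) h t = - \sum_(t | good t) h t.
  rewrite [LHS](reindex_onto flip flip) /=; last exact: flipK.
  rewrite -sumrN; apply: eq_big => [t|t /andP[gft /eqP ffK]].
    apply/andP/idP=> [[gft /eqP <-]|gt]; first exact: flip_good.
    by rewrite flip_good // flipK.
  have {ffK gft} gt : good t by rewrite -ffK; apply: flip_good.
  case: t gt => p [M M'] gt; have [qp Dq memD] := partnerP gt.
  rewrite /h /= prod_swap -mulNr; congr (_ * _).
  case/and3P: (gt) => /= Dp pmM pmM'.
  have [r [rotr r_inf genus_r]] := ext_plane G.
  have simG := simple_add_infinity edges_simple (x := ext G).
  have all_bd := (genus0_homology simG rotr).1 genus_r.
  have matM := pm_matching pmM; have matM' := pm_matching pmM'.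
  have satM : saturated M (comp p M M').
    by move=> u v uv; apply: component_edge; rewrite inE uv.
  have satM' : saturated M' (comp p M M').
    by move=> u v uv; apply: component_edge; rewrite inE uv orbT.
  have degD v : (deg M v != deg M' v) = [exists i, D i && (ext G i == v)].
    have [/codomP[i ->]|v_int] := boolP (v \in codom (ext G)).
      rewrite (degDi i pmM pmM'); apply/idP/existsP=> [Di|[j /andP[Dj /eqP/ext_inj<-]]] //.
      by exists i; rewrite Di eqxx.
    rewrite (pm_int pmM v_int) (pm_int pmM' v_int) eqxx; apply/esym.
    by apply: contraNF v_int => /existsP[i /andP[_ /eqP<-]]; apply: codom_f.
  case/andP: pmM => sM _; case/andP: pmM' => sM' _.
  have := noncrossing edges_simple (@ext_inj _ _ G) rotr r_inf all_bd sM sM' matM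
    matM' degD _ Dp Dq satM satM' memD.
  rewrite eq_sym qp => /(_ isT).
  rewrite /sgn_before -[in X in X -> _]negb_add => neq_odd.
  rewrite -signr_odd -[in RHS]signr_odd; move: neq_odd.
  by case: (odd _); case: (odd _); rewrite ?expr0 ?expr1 ?opprK.
apply/eqP; have /eqP := eq_opp; rewrite -subr_eq0 opprK -mulr2n -mulr_natl.
by rewrite mulf_eq0 (negPf char_not2).
Qed.

End Superposition.

End MatchgateIdentity.

(** * Planarity of subgraphs and subdivisions *)

Lemma perm_extension (T T' : finType) (h : T -> T') (s : {perm T}) : injective h ->
  exists s' : {perm T'}, forall x, s' (h x) = h (s x).
Proof.
move=> inj_h; pose f y := if [pick x | h x == y] is Some x then h (s x) else y.
have fh x : f (h x) = h (s x).
  rewrite /f; case: pickP => [x' /eqP/inj_h->|/(_ x)] //; by rewrite eqxx.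
have fN y : y \notin codom h -> f y = y.
  rewrite /f; case: pickP => // x /eqP<-; by rewrite codom_f.
have inj_f : injective f.
  move=> y z; have [/codomP[x ->]|Ny] := boolP (y \in codom h);
    have [/codomP[x' ->]|Nz] := boolP (z \in codom h); rewrite ?fh ?fN //.
  - by move/inj_h/perm_inj->.
  - by move=> zE; rewrite -zE codom_f in Nz.
  - by move=> yE; rewrite yE codom_f in Ny.
by exists (perm inj_f) => x; rewrite permE.
Qed.

Lemma porbit_morph (T T' : finType) (h : T -> T') (s : {perm T}) (s' : {perm T'}) x :
  (forall x, s' (h x) = h (s x)) -> porbit s' (h x) = h @: porbit s x.
Proof.
move=> s'h; have iter_h k : (s' ^+ k)%g (h x) = h ((s ^+ k)%g x).
  by elim: k => [|k IHk]; rewrite ?perm1 // !expgSr !permM IHk s'h.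
apply/setP=> y; apply/porbitP/imsetP=> [[k ->]|[_ /porbitP[k ->] ->]].
  by exists ((s ^+ k)%g x); rewrite ?mem_porbit.
by exists k.
Qed.

Lemma porbit_step (T : finType) (s : {perm T}) v y :
  y \in porbit s v -> s y \in porbit s v.
Proof. by case/porbitP=> j ->; rewrite -permM -expgSr mem_porbit. Qed.

Lemma porbit_skip (T : finType) (s : {perm T}) v b : v != b -> b \in porbit s v ->
  porbit (s * tperm b (s b))%g v = porbit s v :\ b.
Proof.
move=> vb sb; set s' := (s * _)%g.
have s'E y : y != b -> s' y = if s y == b then s b else s y.
  move=> yb; rewrite permM; case: eqP => [->|/eqP syb]; first by rewrite tpermL.
  by rewrite tpermD // 1?eq_sym // (inj_eq perm_inj).
apply/setP=> y; rewrite in_setD1; apply/idP/andP=> [|[yb /porbitP[k yE]]].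
  case/porbitP=> k ->; elim: k => [|k [IHb IHv]]; first by rewrite perm1 vb porbit_id.
  rewrite expgSr permM s'E //; case: ifPn => [/eqP sy|syb].
    by split; [rewrite -{2}sy (inj_eq perm_inj) eq_sym | apply: porbit_step].
  by split=> //; apply: porbit_step.
rewrite {}yE in yb *; elim/ltn_ind: k yb => -[|k] IHk; first by rewrite perm1 porbit_id.
rewrite expgSr permM; have [skb|skb] := eqVneq ((s ^+ k)%g v) b; last first.
  move=> ssk; have := porbit_step (IHk k (ltnSn k) skb).
  by rewrite s'E // (negPf ssk).
case: k IHk skb => [|k] IHk; first by rewrite perm1 => /eqP; rewrite (negPf vb).
rewrite expgSr permM => skb; rewrite skb => sbb.
have kb : (s ^+ k)%g v != b by apply: contraNneq sbb => kb; rewrite -{2}skb kb.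
have := porbit_step (IHk k (leqnSn _) kb).
by rewrite s'E // skb eqxx.
Qed.

Definition homologically_planar (T : finType) (E : {set {set T}}) (r : T -> {perm T}) :=
  rotation_system E r /\ forall c, chain_cycle E c -> chain_boundary E r c.

Lemma chain_cycle_adj (T : finType) (E : {set {set T}}) c : simple_graph E ->
  chain_cycle E c <-> forall u, \sum_(v | adj E u v) c [set u; v] = 0.
Proof.
move=> simE; suff eq_sum u :
    \sum_(v | adj E u v) c [set u; v] = \sum_(e in E | u \in e) c e.
  by split=> cyc u; have := cyc u; rewrite eq_sum.
rewrite (partition_big (fun v => [set u; v]) (fun e => (e \in E) && (u \in e))) /=.
  apply: eq_bigr => e /andP[Ee ue]; have [v uv eE] := edge_other simE Ee ue.
  rewrite (big_pred1 v) ?eE // => w; apply/andP/eqP=> [[_ /eqP]|->] //.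
  by move/set2_inj.
by move=> v uv; rewrite set21 andbT.
Qed.

Lemma delete_planar (T : finType) (E : {set {set T}}) r a b :
    simple_graph E -> homologically_planar E r -> adj E a b ->
  exists2 r', homologically_planar (E :\ [set a; b]) r' &
    forall u v, adj (E :\ [set a; b]) u v ->
      r' u v = if adj (E :\ [set a; b]) u (r u v) then r u v else r u (r u v).
Proof.
move=> simE [rotr all_bd] ab; set E' := E :\ _.
pose r' u := if u == a then (r a * tperm b (r a b))%g
             else if u == b then (r b * tperm a (r b a))%g else r u.
have adjE' u v : adj E' u v = ([set u; v] != [set a; b]) && adj E u v.
  by rewrite /adj in_setD1.
have adj_a v : adj E' a v = (v != b) && adj E a v.
  rewrite adjE'; congr (~~ _ && _); apply/eqP/eqP=> [/set2_inj|->] //.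
have adj_b v : adj E' b v = (v != a) && adj E b v.
  rewrite adjE' [[set a; b]]setUC; congr (~~ _ && _).
  by apply/eqP/eqP=> [/set2_inj|->].
have adj_o u v : u != a -> u != b -> adj E' u v = adj E u v.
  move=> ua ub; rewrite adjE' andb_idl // => _; apply: contraTneq (set21 u v) => ->.
  by rewrite !inE negb_or ua ub.
have r'E u v : adj E' u v -> r' u v = if adj E' u (r u v) then r u v else r u (r u v).
  rewrite /r'; have [->|ua] := eqVneq u a.
    rewrite !adj_a => /andP[vb av]; rewrite adj_rot // av andbT permM.
    have [->|rvb] := eqVneq (r a v) b; first by rewrite tpermL.
    by rewrite tpermD // 1?eq_sym // (inj_eq perm_inj).
  have [->|ub] := eqVneq u b.
    rewrite !adj_b => /andP[va bv]; rewrite adj_rot // bv andbT permM.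
    have [->|rva] := eqVneq (r b v) a; first by rewrite tpermL.
    by rewrite tpermD // 1?eq_sym // (inj_eq perm_inj).
  by rewrite !adj_o // adj_rot // => ->.
exists r' => //; split.
  move=> u v; rewrite /r'; have [->|ua] := eqVneq u a.
    rewrite adj_a => /andP[vb av]; rewrite porbit_skip ?(rotr _ _ av) ?inE //.
    by apply/setP=> w; rewrite !inE adj_a.
  have [->|ub] := eqVneq u b.
    rewrite adj_b => /andP[va bv].
    rewrite porbit_skip ?(rotr _ _ bv) ?inE 1?adj_sym //.
    by apply/setP=> w; rewrite !inE adj_b.
  rewrite adj_o // => uv; rewrite (rotr _ _ uv).
  by apply/setP=> w; rewrite !inE adj_o.
move=> c' cyc'; pose c e := (e != [set a; b]) && c' e.
have [|f f_face f_bd] := all_bd c.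
  move=> u; rewrite -[RHS](cyc' u) [LHS]big_mkcond [RHS]big_mkcond; apply: eq_bigr => e _.
  rewrite in_setD1 /c; case: (e != _) => //=.
  by case: ifP.
exists f => u v uv'; move: (uv'); rewrite adjE' => /andP[uv_neq uv]; last first.
  by rewrite f_bd // /c uv_neq.
rewrite (r'E v u); last by rewrite adj_sym.
case: ifPn => [_|]; first exact: f_face.
have vr : adj E v (r v u) by rewrite adj_rot // adj_sym.
rewrite adjE' vr andbT negbK => /eqP eq_e.
rewrite f_face; last by rewrite adj_sym.
have := f_bd v (r v u) vr; rewrite /c eq_e eqxx f_face //=.
by case: (f u v); case: (f _ v).
Qed.

Section Subdivision.

Variables (T T' : finType) (i : T -> T') (y : T') (pre : T' -> option T).
Hypotheses (preP : forall z, if pre z is Some t then z = i t else z = y)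
  (pre_i : forall t, pre (i t) = Some t) (pre_y : pre y = None).
Variables (E : {set {set T}}) (E' : {set {set T'}}) (r : T -> {perm T}) (a b : T).
Hypotheses (simE : simple_graph E) (simE' : simple_graph E').
Hypotheses (planar_r : homologically_planar E r) (ab : adj E a b).
Hypotheses (adj_i : forall u w,
    adj E' (i u) (i w) = ([set u; w] != [set a; b]) && adj E u w)
  (adj_y : forall u, adj E' y (i u) = (u == a) || (u == b)).

Definition subdivide u w := if [set u; w] == [set a; b] then y else i w.

Let inj_i : injective i. Proof. by move=> u w /(congr1 pre); rewrite !pre_i => -[]. Qed.
Let i_neq_y u : i u != y.
Proof. by apply/eqP=> /(congr1 pre); rewrite pre_i pre_y. Qed.
Let neq_ab := adj_neq simE ab.

Let specialP u w : [set u; w] = [set a; b] -> u = a /\ w = b \/ u = b /\ w = a.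
Proof.
move=> eq_uw; have: u \in [set a; b] by rewrite -eq_uw set21.
case/set2P=> uE; move: eq_uw; rewrite uE; first by move/set2_inj; left.
by rewrite [RHS]setUC => /set2_inj; right.
Qed.

Let inj_sub u : injective (subdivide u).
Proof.
move=> w w'; rewrite /subdivide; case: eqP => [<-|_]; case: eqP => [|_].
- by move/set2_inj.
- by move/esym/eqP; rewrite (negPf (i_neq_y _)).
- by move=> _ /eqP; rewrite (negPf (i_neq_y _)).
- exact: inj_i.
Qed.

Let adj_sub u w : adj E' (i u) (subdivide u w) = adj E u w.
Proof.
rewrite /subdivide; case: eqP => [eq_uw|/eqP neq]; last by rewrite adj_i neq.
by rewrite /adj eq_uw [LHS]adj_sym adj_y; case: (specialP eq_uw) => -[-> _];
  rewrite eqxx ?orbT; exact/esym.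
Qed.

Let nbP u z : adj E' (i u) z -> exists2 w, adj E u w & z = subdivide u w.
Proof.
have := preP z; case: (pre z) => [w|] ->.
  rewrite adj_i => /andP[neq uw]; exists w => //.
  by rewrite /subdivide (negPf neq).
rewrite adj_sym adj_y => /orP[]/eqP->.
  by exists b; rewrite ?ab // /subdivide eqxx.
by exists a; rewrite 1?adj_sym // /subdivide [[set b; a]]setUC eqxx.
Qed.

Lemma subdivide_planar : exists2 r', homologically_planar E' r' &
  forall u w, r' (i u) (subdivide u w) = subdivide u (r u w).
Proof.
have [rotr all_bd] := planar_r.
have /fin_all_exists[r1 r1E] : forall u, exists s : {perm T'},
    forall w, s (subdivide u w) = subdivide u (r u w).
  by move=> u; apply: perm_extension.
pose r' z := if pre z is Some u then r1 u else tperm (i a) (i b).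
have r'i u w : r' (i u) (subdivide u w) = subdivide u (r u w).
  by rewrite /r' pre_i r1E.
have r'y : r' y = tperm (i a) (i b) by rewrite /r' pre_y.
exists r' => //; split=> [z z' zz'|c' /chain_cycle_adj-/(_ simE') cyc'].
  have := preP z; case: (pre z) => [u|] zE; rewrite {}zE in zz' *.
    have [w uw ->] := nbP zz'; rewrite (porbit_morph _ (r'i u)) (rotr _ _ uw).
    apply/setP=> x; rewrite inE; apply/imsetP/idP=> [[v + ->]|/nbP[v uv ->]].
      by rewrite inE adj_sub.
    by exists v; rewrite ?inE.
  have nb_y x : adj E' y x = (x \in [set i a; i b]).
    have := preP x; case: (pre x) => [w|] ->; first by rewrite adj_y !inE !(inj_eq inj_i).
    rewrite !inE ![y == _]eq_sym !(negPf (i_neq_y _)); apply/negP=> /(adj_neq simE').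
    by rewrite eqxx.
  rewrite r'y; transitivity [set i a; i b]; last first.
    by apply/setP=> x; rewrite [RHS]inE nb_y.
  apply/eqP; rewrite eqEsubset; apply/andP; split; apply/subsetP=> x.
    case/porbitP=> k ->; elim: k => [|k]; first by rewrite perm1 -nb_y.
    by rewrite expgSr permM => /set2P[]->; rewrite ?tpermL ?tpermR !inE eqxx ?orbT.
  move: zz'; rewrite nb_y => /set2P[]-> /set2P[]->; rewrite ?porbit_id //.
    by apply/porbitP; exists 1%N; rewrite expg1 tpermL.
  by apply/porbitP; exists 1%N; rewrite expg1 tpermR.
have c'y : c' [set y; i a] = c' [set y; i b].
  have := cyc' y; rewrite (bigD1 (i a)) /=; last by rewrite adj_y eqxx.
  rewrite (bigD1 (i b)) /=; last by rewrite adj_y eqxx orbT (inj_eq inj_i) eq_sym.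
  rewrite big1 => [|x /andP[/andP[yx xa] xb]].
    by case: (c' _); case: (c' _).
  have := preP x; case: (pre x) => [w|] xE; rewrite {}xE in yx xa xb *.
    by move: yx xa xb; rewrite adj_y !(inj_eq inj_i) => /orP[]->.
  by have := adj_neq simE' yx; rewrite eqxx.
pose c e := if e == [set a; b] then c' [set y; i a] else c' [set i u | u in e].
have cE u w : c' [set i u; subdivide u w] = c [set u; w].
  rewrite /c /subdivide; case: eqP => [eq_uw|_]; last by rewrite imsetU1 imset_set1.
  by rewrite setUC; case: (specialP eq_uw) => -[-> _].
have [|f f_face f_bd] := all_bd c.
  apply/(chain_cycle_adj _ simE) => u; rewrite -[RHS](cyc' (i u)).
  rewrite (reindex_onto (subdivide u) (fun z => if pre z is Some w then w
                                          else if u == a then b else a)) /=.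
    apply: eq_big => w; last by rewrite cE.
    rewrite adj_sub; apply/esym/andb_idr => _; rewrite /subdivide.
    case: ifP => [/eqP/specialP|_]; last by rewrite pre_i.
    by rewrite pre_y; case=> -[-> ->]; rewrite ?eqxx // (eq_sym b a) (negPf neq_ab) ?eqxx.
  move=> z /nbP[w _ ->]; rewrite {2}/subdivide.
  case: ifP => [/eqP/specialP|_]; last by rewrite pre_i.
  by rewrite pre_y; case=> -[-> ->]; rewrite ?eqxx // (eq_sym b a) (negPf neq_ab) ?eqxx.
pose k u z := if pre z is Some w then w else if u == a then b else a.
pose f' z z' := if pre z is Some u then f u (k u z') else if z' == i b then f a b else f b a.
have f'i u w : f' (i u) (subdivide u w) = f u w.
  rewrite /f' pre_i /k /subdivide.
  case: ifP => [/eqP/specialP|_]; last by rewrite pre_i.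
  by rewrite pre_y; case=> -[-> ->]; rewrite ?eqxx // (eq_sym b a) (negPf neq_ab) ?eqxx.
have f'yb : f' y (i b) = f a b by rewrite /f' pre_y eqxx.
have f'ya : f' y (i a) = f b a by rewrite /f' pre_y (inj_eq inj_i) (negPf neq_ab).
have sub_ab : subdivide a b = y by rewrite /subdivide eqxx.
have sub_ba : subdivide b a = y by rewrite /subdivide [[set b; a]]setUC eqxx.
have f'ay : f' (i a) y = f a b by rewrite -sub_ab f'i.
have f'by : f' (i b) y = f b a by rewrite -sub_ba f'i.
have ba : adj E b a by rewrite adj_sym.
exists f' => z z'; have := preP z; case: (pre z) => [u|] ->;
  have := preP z'; case: (pre z') => [w|] ->.
- rewrite adj_i => /andP[neq uw]; have neq' : [set w; u] != [set a; b] by rewrite setUC.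
  have -> : i u = subdivide w u by rewrite /subdivide (negPf neq').
  rewrite r'i f'i f_face // -(f'i u w) /subdivide.
  by rewrite (negPf neq) (negPf neq').
- rewrite adj_sym adj_y => /orP[]/eqP->; rewrite r'y ?tpermL ?tpermR.
    by rewrite f'yb f'ay.
  by rewrite f'ya f'by.
- rewrite adj_y => /orP[]/eqP->.
    by rewrite -{1}sub_ab r'i f'i f'ya f_face.
  by rewrite -{1}sub_ba r'i f'i f'yb f_face.
- by move/(adj_neq simE'); rewrite eqxx.
- rewrite adj_i => /andP[neq uw]; have neq' : [set w; u] != [set a; b] by rewrite setUC.
  have subE : i w = subdivide u w by rewrite /subdivide (negPf neq).
  have subE' : i u = subdivide w u by rewrite /subdivide (negPf neq').
  by rewrite {1 3}subE f'i cE subE' f'i f_bd.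
- rewrite adj_sym adj_y => /orP[]/eqP->; rewrite setUC.
    by rewrite f'ay f'ya f_bd // /c eqxx.
  by rewrite f'by f'yb f_bd // -c'y /c [[set b; a]]setUC eqxx.
- rewrite adj_y => /orP[]/eqP->.
    by rewrite f'ay f'ya addrC f_bd // /c eqxx.
  by rewrite f'by f'yb addrC f_bd // -c'y /c [[set b; a]]setUC eqxx.
- by move/(adj_neq simE'); rewrite eqxx.
Qed.

End Subdivision.

Lemma star_planar N : exists r : option 'I_N -> {perm option 'I_N},
  homologically_planar (add_infinity set0 (@id 'I_N)) r
  /\ forall i, r None (Some i) = Some (ordS i).
Proof.
have inj_S : injective (@ordS N) := can_inj (@ordSK N).
have inj_Some : injective (@Some 'I_N) by move=> i j [].
have [s sE] := perm_extension (perm inj_S) inj_Some.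
have {}sE i : s (Some i) = Some (ordS i) by rewrite sE permE.
have sim0 : simple_graph (set0 : {set {set 'I_N}}) by move=> e; rewrite inE.
have simS := simple_add_infinity sim0 (x := @id 'I_N).
have adjNS (i : 'I_N) : adj (add_infinity set0 id) None (Some i).
  by rewrite adj_infinity_None codom_f.
have adjSS (i j : 'I_N) : adj (add_infinity set0 id) (Some i) (Some j) = false.
  by rewrite adj_infinity_Some /adj inE.
exists (fun u => if u is None then s else 1%g); split=> [|//]; split.
  move=> [i|] [j|]; rewrite ?adjSS ?adj_infinity_None2 // => _.
    rewrite (_ : porbit _ _ = [set None]).
      by apply/setP=> -[j|]; rewrite !inE ?adjSS // adj_sym adjNS.
    by apply/setP=> u; rewrite inE; apply/porbitP/eqP => [[k ->]|->];
      [rewrite expg1n perm1|exists 0%N; rewrite perm1].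
  apply/setP=> -[k|]; rewrite inE ?adjNS ?adj_infinity_None2.
    have iter_s m : (s ^+ m)%g (Some j) = Some (iter m (@ordS N) j).
      by elim: m => [|m IHm]; rewrite ?perm1 // expgSr permM IHm sE.
    apply/porbitP; exists (k + N - j)%N; rewrite iter_s; congr Some.
    have val_iter m : val (iter m (@ordS N) j) = ((j + m) %% N)%N.
      elim: m => [|m IHm]; first by rewrite addn0 modn_small.
      by rewrite iterS /= IHm -addn1 modnDml addn1 addnS.
    apply: val_inj; rewrite val_iter /= subnKC; last by rewrite ltnW // ltn_addl.
    by rewrite modnDr modn_small.
  apply/negP=> /porbitP[m]; elim: m => [|m IHm]; first by rewrite perm1.
  rewrite expgSr permM; case: ((s ^+ m)%g (Some j)) IHm => [i _|/(_ erefl)//].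
  by rewrite sE.
move=> c /chain_cycle_adj-/(_ simS) cyc; exists (fun _ _ => false) => // u v uv.
have c0 i : c [set None; Some i] = false.
  have := cyc (Some i); rewrite (big_pred1 None) => [|w]; first by rewrite setUC.
  by case: w => [j|] /=; rewrite ?adjSS // adj_sym adjNS.
case: u v uv => [i|] [j|] uv; rewrite ?c0 // ?adjSS ?adj_infinity_None2 // in uv *.
by rewrite setUC c0.
Qed.

(** * Operations on matchgates *)

Lemma plane_with_externalP (V : finType) (E : {set {set V}}) N (x : 'I_N -> V) :
  simple_graph E ->
  plane_with_external E x <->
  exists2 r, homologically_planar (add_infinity E x) r &
             forall i, r None (Some (x i)) = Some (x (ordS i)).
Proof.
move=> simE; have simI := simple_add_infinity simE (x := x).
split=> [[r [rotr r_inf genus_r]]|[r [rotr all_bd] r_inf]]; exists r => //.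
  by split=> //; apply/(genus0_homology simI rotr).
by split=> //; apply/(genus0_homology simI rotr).
Qed.

Section Star.

Variables (F : fieldType) (N : nat).

Let star_plane : plane_with_external set0 (@id 'I_N).
Proof.
apply/plane_with_externalP; first by move=> e; rewrite inE.
by have [r [planar_r r_inf]] := star_planar N; exists r.
Qed.

Let star_simple e : e \in (set0 : {set {set 'I_N}}) -> #|e| = 2%N.
Proof. by rewrite inE. Qed.

Definition star : matchgate F N :=
  @Matchgate F N 'I_N set0 (fun _ => 1) id star_simple (@inj_id 'I_N) star_plane.

Lemma sig_star X : sig star X = [forall i, X i]%:R.
Proof.
have degE (v : 'I_N) : deg (set0 : {set {set 'I_N}}) v = 0%N.
  by rewrite /deg setIdE set0I cards0.
have pm0 : pm (G := star) X set0 = [forall i, X i].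
  rewrite /pm sub0set; apply: eq_forallb => v; rewrite degE /=.
  have -> : [exists i, X i && (i == v)] = X v; last by case: (X v).
  apply/existsP/idP=> [[i /andP[Xi /eqP<-]]|Xv] //.
  by exists v; rewrite Xv eqxx.
rewrite sigE; case: (boolP [forall i, X i]) pm0 => [allX|nX] pm0.
  rewrite (big_pred1 set0) ?big_set0 // => M.
  apply/idP/eqP=> [/andP[]|->]; last exact: pm0.
  by rewrite subset0 => /eqP.
rewrite big_pred0 // => M; apply/negP=> pmM; case/andP: (pmM).
by rewrite /= subset0 => /eqP M0 _; rewrite M0 pm0 in pmM.
Qed.

End Star.

Section Flip.

Variables (F : fieldType) (N : nat) (G : matchgate F N) (i : 'I_N) (w : F).
Let V := node G.

Definition flip_edges : {set {set option V}} :=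
  @lift_edge _ @: edges G :|: [set spoke (ext G i)].

Definition flip_ext (j : 'I_N) : option V := if j == i then None else Some (ext G j).

Definition flip_weight (e : {set option V}) : F :=
  if e == spoke (ext G i) then w else weight [set v | Some v \in e].

Lemma flip_simple e : e \in flip_edges -> #|e| = 2%N.
Proof.
case/setUP=> [/imsetP[e' Ee ->]|/set1P->]; last by rewrite cards2.
by rewrite card_imset ?edges_card2 // => u v [].
Qed.

Lemma flip_ext_inj : injective flip_ext.
Proof.
move=> j k; rewrite /flip_ext; case: eqP => [->|_]; case: eqP => [->|_] //.
by case=> /ext_inj.
Qed.

Lemma adj_flip_Some u v : adj flip_edges (Some u) (Some v) = adj (edges G) u v.
Proof.
rewrite /adj inE -lift_edge2 (mem_imset _ _ (@lift_edge_inj V)) inE.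
case: (_ \in edges G) => //=; apply/eqP=> /setP/(_ None).
by rewrite None_lift_edge !inE.
Qed.

Lemma adj_flip_None v : adj flip_edges None (Some v) = (v == ext G i).
Proof.
rewrite /adj inE inE (inj_eq (@spoke_inj V)) orbC; case: (v == _) => //=.
by apply/imsetP=> -[e _ /setP/(_ None)]; rewrite None_lift_edge !inE.
Qed.

Lemma codom_flip_ext v :
  (Some v \in codom flip_ext) = (v != ext G i) && (v \in codom (ext G)).
Proof.
apply/codomP/andP=> [[j]|[vi /codomP[j vE]]].
  rewrite /flip_ext; case: eqP => // /eqP ji [->].
  by rewrite (inj_eq (@ext_inj _ _ G)) codom_f.
by exists j; rewrite /flip_ext vE; case: eqP => // ji; rewrite vE ji eqxx in vi.
Qed.

Lemma flip_plane : plane_with_external flip_edges flip_ext.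
Proof.
have simE := @edges_simple _ _ G; have simE' : simple_graph flip_edges := flip_simple.
have [r planar_r r_inf] := (plane_with_externalP _ simE).1 (ext_plane G).
have simI := simple_add_infinity simE (x := ext G).
have simI' := simple_add_infinity simE' (x := flip_ext).
pose iota (u : option V) := omap Some u.
pose pre (z : option (option V)) : option (option V) :=
  match z with None => Some None | Some None => None | Some (Some v) => Some (Some v) end.
have ab : adj (add_infinity (edges G) (ext G)) None (Some (ext G i)).
  by rewrite adj_infinity_None codom_f.
have sNS (u : V) : [set Some u; None] = spoke u by rewrite setUC.
have spokeS (u v t : V) : ([set Some u; Some v] == spoke t) = false.
  by apply/eqP=> /setP/(_ None); rewrite !inE.
have [] := @subdivide_planar _ _ iota (Some None) pre _ _ _ (add_infinity (edges G) (ext G))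
  (add_infinity flip_edges flip_ext) r None (Some (ext G i)) simI simI' planar_r ab.
- by case=> [[v|]|].
- by case=> [v|].
- by [].
- case=> [u|] [v|] /=; rewrite -/(spoke _) ?spokeS.
  + by rewrite !adj_infinity_Some adj_flip_Some.
  + rewrite sNS (inj_eq (@spoke_inj V)) adj_sym adj_infinity_None codom_flip_ext.
    by rewrite [in RHS]adj_sym adj_infinity_None.
  + by rewrite (inj_eq (@spoke_inj V)) adj_infinity_None codom_flip_ext adj_infinity_None.
  + by rewrite !adj_infinity_None2 andbF.
- case=> [u|] /=; first by rewrite adj_infinity_Some adj_flip_None.
  rewrite adj_sym adj_infinity_None; apply/codomP; exists i.
  by rewrite /flip_ext eqxx.
move=> r' planar_r' r'E; apply/plane_with_externalP => //; exists r' => // j.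
have subE k : subdivide iota (Some None) None (Some (ext G i)) None (Some (ext G k))
    = Some (flip_ext k).
  rewrite /subdivide -!/(spoke _) (inj_eq (@spoke_inj V)) (inj_eq (@ext_inj _ _ G)).
  by rewrite /flip_ext; case: eqP.
by have := r'E None (Some (ext G j)); rewrite r_inf !subE.
Qed.

Definition flip : matchgate F N :=
  @Matchgate F N (option V) flip_edges flip_weight flip_ext flip_simple
    flip_ext_inj flip_plane.

Let up (b : bool) (M : {set {set V}}) : {set {set option V}} :=
  @lift_edge _ @: M :|: (if b then [set spoke (ext G i)] else set0).
Let down (M : {set {set option V}}) : {set {set V}} := [set e | lift_edge e \in M].

Let spoke_lift (e : {set V}) v : spoke v != lift_edge e.
Proof. by apply/eqP=> /setP/(_ None); rewrite None_lift_edge !inE. Qed.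

Let mem_up b M e : (lift_edge e \in up b M) = (e \in M).
Proof.
rewrite inE (mem_imset _ _ (@lift_edge_inj V)); case: b; rewrite ?inE ?orbF //.
by rewrite eq_sym (negPf (spoke_lift _ _)) orbF.
Qed.

Let upK b : cancel (up b) down.
Proof. by move=> M; apply/setP=> e; rewrite inE mem_up. Qed.

Let deg_up_None b M : deg (up b M) None = b.
Proof.
rewrite /deg (_ : [set e in _ | _] = if b then [set spoke (ext G i)] else set0).
  by case: b; rewrite ?cards1 ?cards0.
apply/setP=> e; rewrite !inE andb_orl.
rewrite (_ : (e \in @lift_edge _ @: M) && _ = false) /=; last first.
  by apply/andP=> -[/imsetP[e' _ ->]]; rewrite None_lift_edge.
by case: b; rewrite !inE //; apply: andb_idr => /eqP->; rewrite set21.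
Qed.

Let deg_up_Some b M v : deg (up b M) (Some v) = (deg M v + (b && (v == ext G i)))%N.
Proof.
rewrite /deg; have -> : [set e in up b M | Some v \in e] =
    @lift_edge _ @: [set e in M | v \in e]
      :|: (if b && (v == ext G i) then [set spoke (ext G i)] else set0).
  apply/setP=> e; rewrite !inE andb_orl; congr (_ || _).
    apply/andP/imsetP=> [[/imsetP[e' Me' ->]]|[e' + ->]].
      by rewrite mem_lift_edge => ve; exists e'; rewrite // inE Me'.
    by rewrite inE mem_lift_edge => /andP[Me ->]; rewrite imset_f.
  case: b; rewrite !inE //=; case: (e =P spoke _) => [->|/eqP neq] /=.
    by rewrite mem_spoke; case: eqP => // _; rewrite !inE ?eqxx.
  by case: eqP; rewrite !inE // (negPf neq).
rewrite cardsU (_ : _ :&: _ = set0) ?cards0 ?subn0; last first.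
  apply/setP=> e; rewrite !inE; apply/negP=> /andP[/imsetP[e' _ ->]].
  by case: ifP => _; rewrite !inE // eq_sym (negPf (spoke_lift _ _)).
rewrite card_imset; last exact: lift_edge_inj.
by case: ifP; rewrite ?cards1 ?cards0.
Qed.

Let pm_up X M : pm (G := flip) X (up (~~ X i) M) = pm (X + unit_bit i) M.
Proof.
have upS : (up (~~ X i) M \subset edges flip) = (M \subset edges G).
  apply/subsetP/subsetP=> sub e.
    rewrite -(mem_up (~~ X i)) => /sub; rewrite inE (mem_imset _ _ (@lift_edge_inj V)).
    by rewrite inE eq_sym (negPf (spoke_lift _ _)) orbF.
  rewrite !inE => /orP[/imsetP[e' /sub Ee' ->]|]; first by rewrite imset_f.
  by case: (X i); rewrite !inE // => ->; rewrite orbT.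
have ext_i : Some (ext G i) \notin codom flip_ext by rewrite codom_flip_ext eqxx.
have extE j : j != i -> flip_ext j = Some (ext G j).
  by rewrite /flip_ext => /negPf->.
have ext_neq j : j != i -> (ext G j == ext G i) = false.
  by rewrite (inj_eq (@ext_inj _ _ G)) => /negPf.
apply/idP/idP=> pmM; apply: pmI => [|j|v v_int].
- by rewrite -upS; case/andP: pmM.
- rewrite !ffunE; have [->|ji] := eqVneq j i.
    have := pm_int pmM ext_i; rewrite deg_up_Some eqxx andbT.
    by case: (X i); case: (deg M _) => [|[]].
  have := pm_ext j pmM; rewrite /= extE // deg_up_Some ext_neq // andbF !addn0 => ->.
  by case: (X j).
- have v_neq : v != ext G i by apply: contraNneq v_int => ->; apply: codom_f.
  have /(pm_int pmM) : Some v \notin codom flip_ext by rewrite codom_flip_ext v_neq.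
  by rewrite deg_up_Some (negPf v_neq) andbF addn0.
- by rewrite upS; case/andP: pmM.
- have [->|ji] := eqVneq j i; first by rewrite /= /flip_ext eqxx deg_up_None.
  rewrite /= extE // deg_up_Some ext_neq // andbF addn0 (pm_ext j pmM).
  by rewrite !ffunE (negPf ji); case: (X j).
- case: v v_int => [v|] /=; last first.
    by case/codomP; exists i; rewrite /flip_ext eqxx.
  rewrite codom_flip_ext deg_up_Some; have [->|v_neq] /= := eqVneq v (ext G i).
    by rewrite (pm_ext i pmM) !ffunE eqxx andbT; case: (X i).
  by move=> v_int; rewrite (pm_int pmM v_int) andbF.
Qed.

Lemma sig_flip X : sig flip X = (if X i then 1 else w) * sig G (X + unit_bit i).
Proof.
rewrite !sigE mulr_sumr (reindex_onto (up (~~ X i)) down) /=; last first.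
  move=> M pmM; apply/setP=> e; have : e \in M -> e \in flip_edges.
    by case/andP: pmM => /subsetP sub _ /sub.
  have [/imsetP[e' _ ->]|e_lift] := boolP (e \in [set lift_edge e' | e' : {set V}]).
    by move=> _; rewrite mem_up inE.
  move=> sub; have -> : (e \in up (~~ X i) (down M)) = ~~ X i && (e == spoke (ext G i)).
    rewrite inE (_ : e \in @lift_edge _ @: _ = false) /=; last first.
      by apply: contraNF e_lift => /imsetP[e' _ ->]; apply: imset_f.
    by case: (X i); rewrite !inE.
  have {}sub : e \in M -> e = spoke (ext G i).
    move/sub; rewrite !inE => /orP[/imsetP[e' _ eE]|/eqP//].
    by rewrite eE imset_f in e_lift.
  have degN : deg M None = ~~ X i.
    by have := pm_ext i pmM; rewrite /= /flip_ext eqxx.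
  have [Me|nMe] := boolP (e \in M).
    rewrite (sub Me) eqxx andbT; suff: (0 < ~~ X i)%N by rewrite lt0b.
    rewrite -degN; apply/card_gt0P.
    by exists e; rewrite inE Me (sub Me) set21.
  apply/negP=> /andP[Xi /eqP eE]; have : (0 < deg M None)%N by rewrite degN Xi.
  case/card_gt0P=> e'; rewrite inE => /andP[Me' Ne'].
  have : e' \in flip_edges by case/andP: pmM => /subsetP sub' _; apply: sub'.
  rewrite !inE => /orP[/imsetP[e'' _ e'E]|/eqP e'E].
    by rewrite e'E None_lift_edge in Ne'.
  by rewrite eE -e'E Me' in nMe.
apply: eq_big => [M|M _]; first by rewrite pm_up upK eqxx andbT.
have prod_lift : \prod_(e in @lift_edge _ @: M) flip_weight e = \prod_(e in M) weight e.
  rewrite big_imset /=; last by move=> e e' _ _ /lift_edge_inj.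
  apply: eq_bigr => e _; rewrite /flip_weight eq_sym (negPf (spoke_lift _ _)).
  by congr weight; apply/setP=> v; rewrite inE mem_lift_edge.
rewrite /up; case: (X i) => /=; first by rewrite setU0 mul1r prod_lift.
rewrite setUC big_setU1 /= ?prod_lift; first by rewrite /flip_weight eqxx.
by apply/imsetP=> -[e _ /eqP]; rewrite (negPf (spoke_lift _ _)).
Qed.

End Flip.

Section Drop.

Variables (F : fieldType) (N : nat) (G : matchgate F N.+1) (k : 'I_N.+1).

Definition drop_ext (i : 'I_N) : node G := ext G (lift k i).

Lemma drop_ext_inj : injective drop_ext.
Proof. by move=> i j /ext_inj/lift_inj. Qed.

Lemma drop_plane : plane_with_external (edges G) drop_ext.
Proof.
have simE := @edges_simple _ _ G.
have [r planar_r r_inf] := (plane_with_externalP _ simE).1 (ext_plane G).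
have simI := simple_add_infinity simE (x := ext G).
have dropE : add_infinity (edges G) drop_ext
    = add_infinity (edges G) (ext G) :\ [set None; Some (ext G k)].
  rewrite -/(spoke _) !add_infinityE; apply/setP=> e; rewrite !inE.
  have [/imsetP[e0 _ ->]|_] /= := boolP (e \in [set lift_edge e | e in edges G]).
    rewrite andbT; apply/esym/eqP=> /setP/(_ None).
    by rewrite None_lift_edge !inE.
  apply/imsetP/andP=> [[i _ ->]|[ek /imsetP[i _ eE]]].
    rewrite (inj_eq (@spoke_inj _)) (inj_eq (@ext_inj _ _ G)) eq_sym neq_lift.
    by split=> //; apply: (imset_f (fun i => spoke (ext G i))).
  case: (unliftP k i) eE => [j ->|->] eE; first by exists j.
  by rewrite eE eqxx in ek.
have kN : adj (add_infinity (edges G) (ext G)) None (Some (ext G k)).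
  by rewrite adj_infinity_None codom_f.
have [r' planar_r' r'E] := delete_planar simI planar_r kN.
rewrite -dropE in planar_r' r'E.
apply/plane_with_externalP => //; exists r' => // i.
have adjN j : adj (add_infinity (edges G) drop_ext) None (Some (ext G j)) = (j != k).
  rewrite adj_infinity_None; apply/codomP/idP=> [[j' /ext_inj->]|jk].
    by rewrite eq_sym neq_lift.
  by case: (unliftP k j) jk => [j' ->|->]; [exists j'|rewrite eqxx].
rewrite r'E; last by rewrite adjN eq_sym neq_lift.
have wrap m n : (m <= n)%N -> (m %% n = if m == n then 0 else m)%N.
  by rewrite leq_eqVlt; case: eqP => [->|_ /modn_small]; rewrite ?modnn.
have lt_i := ltn_ord i; have lt_k := ltn_ord k.
have valS : val (ordS (lift k i)) = (if (k <= i) + i == N then 0 else ((k <= i) + i).+1)%N.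
  by rewrite /= /bump wrap //; case: (leqP k i) => /= _; lia.
have valL : val (lift k (ordS i))
    = (if i.+1 == N then (k == 0%N :> nat) : nat else (k <= i.+1) + i.+1)%N.
  by rewrite /= /bump wrap //; case: eqP => // _; rewrite leqn0 addn0.
rewrite r_inf adjN /drop_ext r_inf; case: ifPn => [|/negPn/eqP Sk].
  rewrite -val_eqE valS => Sk; congr (Some (ext G _)); apply: val_inj.
  rewrite valS valL; move: Sk => /=.
  case: (leqP k i) => ki; case: (i.+1 =P N) => iN; rewrite ?add1n ?add0n /=;
    case: (leqP k i.+1) => ki1; rewrite /= ?iN ?eqxx ?add0n ?add1n; try lia;
    case: (nat_of_ord i =P N) => ?; lia.
congr (Some (ext G _)); apply: val_inj; rewrite valL Sk /=.
move: (congr1 val Sk); rewrite valS /= => {}Sk; rewrite wrap //.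
move: Sk; case: (leqP k i) => ki; case: (i.+1 =P N) => iN; rewrite ?add1n ?add0n /=;
  case: (leqP k i.+1) => ki1; rewrite /= ?iN ?eqxx ?add0n ?add1n eqSS;
  case: (nat_of_ord i =P N) => ? ?; case: (nat_of_ord k =P N) => ?; lia.
Qed.

Definition drop_external : matchgate F N :=
  @Matchgate F N (node G) (edges G) (@weight _ _ G) drop_ext (@edges_card2 _ _ G)
    drop_ext_inj drop_plane.

Lemma sig_drop X :
  sig drop_external X = sig G [ffun j => if unlift k j is Some i then X i else false].
Proof.
rewrite /sig; congr perf_match; apply/setP=> v; apply/imsetP/imsetP=> -[i].
  rewrite inE => Xi ->; exists (lift k i) => //.
  by rewrite inE ffunE liftK.
rewrite inE ffunE; case: unliftP => // j -> Xj ->.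
by exists j; rewrite ?inE.
Qed.

End Drop.

Section Realizable.

Variable F : fieldType.

Definition realizable N (Gam : bits N -> F) := exists G : matchgate F N, Gam =1 sig G.

Lemma eq_realizable N (Gam Gam' : bits N -> F) :
  Gam =1 Gam' -> realizable Gam -> realizable Gam'.
Proof. by move=> eqG [G GE]; exists G => X; rewrite -eqG GE. Qed.

Lemma realizable_flip N (Gam : bits N -> F) i w : realizable Gam ->
  realizable (fun X => (if X i then 1 else w) * Gam (X + unit_bit i)).
Proof. by case=> G GE; exists (flip G i w) => X; rewrite sig_flip GE. Qed.

Lemma realizable_shift N (Gam : bits N -> F) U : realizable Gam ->
  realizable (fun X => Gam (X + U)).
Proof.
move=> realG; have -> : U = \sum_(i <- enum 'I_N | U i) unit_bit i.
  apply/ffunP=> j; rewrite sum_ffunE big_enum_cond /=.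
  rewrite (eq_bigr (fun i => (i == j) : bool)) => [|i _]; last by rewrite ffunE eq_sym.
  rewrite sum_bool_odd; case Uj: (U j).
    rewrite (eq_card (B := pred1 j)) ?card1 // => i; rewrite !inE.
    by apply: andb_idl => /eqP->.
  by rewrite eq_card0 // => i; rewrite !inE; apply/andP=> -[Ui /eqP ij]; rewrite -ij Ui in Uj.
elim: (enum _) => [|i s IHs].
  by apply: eq_realizable realG => X; rewrite big_nil addr0.
rewrite big_cons; case: (U i) => //; have := realizable_flip i 1 IHs.
by apply: eq_realizable => X; rewrite if_same mul1r addrA.
Qed.

Lemma realizable_weight N (Gam : bits N -> F) (w : 'I_N -> bool -> F) : realizable Gam ->
  realizable (fun X => (\prod_i w i (X i)) * Gam X).
Proof.
move=> realG; suff : realizable (fun X => (\prod_(i <- enum 'I_N) w i (X i)) * Gam X).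
  by apply: eq_realizable => X; rewrite big_enum.
elim: (enum _) => [|i s IHs].
  by apply: eq_realizable realG => X; rewrite big_nil mul1r.
have := realizable_flip i (w i false) (realizable_flip i (w i true) IHs).
apply: eq_realizable => X; rewrite big_cons.
have -> : X + unit_bit i + unit_bit i = X.
  by apply/ffunP=> j; rewrite !ffunE; case: (X j); case: (j == i).
rewrite !ffunE eqxx !mulrA; congr (_ * _ * _).
by case: (X i); rewrite ?mul1r ?mulr1.
Qed.

Definition embed M N (h : 'I_M -> 'I_N) (X : bits M) : bits N :=
  [ffun j => [exists i, X i && (h i == j)]].

Lemma homo_ord_id n (h : 'I_n -> 'I_n) : {homo h : i j / (i < j)%N} -> h =1 id.
Proof.
move=> homo_h; have ge_h : forall m (lt_m : (m < n)%N), (m <= h (Ordinal lt_m))%N.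
  elim=> // m IHm lt_m; apply: leq_ltn_trans (IHm (ltnW lt_m)) _.
  exact: homo_h.
have le_h : forall m (i : 'I_n), (i + m).+1 = n -> (h i <= i)%N.
  elim=> [|m IHm] i iE; first by have := ltn_ord (h i); lia.
  have lt_i : (i.+1 < n)%N by lia.
  have := IHm (Ordinal lt_i); rewrite /= addSnnS => /(_ iE).
  have /(homo_h i) : (i < Ordinal lt_i)%N by [].
  by move=> lt_h /(leq_trans lt_h).
move=> i; apply: val_inj; apply/eqP; rewrite eqn_leq.
rewrite (le_h (n - i.+1)%N) /=; last by have := ltn_ord i; lia.
by case: i => m lt_m; apply: ge_h.
Qed.

Lemma realizable_sub M N (h : 'I_M -> 'I_N) (Gam : bits N -> F) :
    {homo h : i j / (i < j)%N} -> realizable Gam ->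
  realizable (fun X => Gam (embed h X)).
Proof.
elim: N h Gam => [|N IHN] h Gam homo_h realG.
  case: M h homo_h => [|M] h homo_h; last by case: (h ord0).
  by apply: eq_realizable realG => X; congr Gam; apply/ffunP=> -[].
have [k kh|surj_h] := pickP [pred k | k \notin codom h].
  have /fin_all_exists[h' h'E] i : exists j, h i = lift k j.
    have : k != h i by apply: contraNneq kh => ->; apply: codom_f.
    by case/unlift_some=> j ->; exists j.
  have [G GE] := realG.
  have realD : realizable (sig (drop_external G k)) by exists (drop_external G k).
  have {realD} := IHN h' _ _ realD; case=> [i j /homo_h|G' G'E].
    by rewrite !h'E /= /bump; lia.
  exists G' => X; rewrite -G'E sig_drop GE; congr sig; apply/ffunP=> j.
  rewrite !ffunE; case: unliftP => [j' ->|->].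
    rewrite ffunE; apply: eq_existsb => i.
    by rewrite h'E (inj_eq (@lift_inj _ k)).
  apply/existsP=> -[i /andP[_ /eqP hk]].
  by rewrite inE -hk codom_f in kh.
have inj_h : injective h.
  move=> i j hij; apply: val_inj; apply/eqP; rewrite eqn_leq leqNgt [X in _ && X]leqNgt.
  by apply/andP; split; apply/negP=> /homo_h; rewrite hij ltnn.
have MN : M = N.+1.
  have := card_codom inj_h; rewrite !card_ord => <-.
  rewrite -[RHS](card_ord N.+1); apply: eq_card => k.
  by have /negbFE := surj_h k.
subst M; apply: eq_realizable realG => X; congr Gam; apply/ffunP=> j.
rewrite ffunE; apply/idP/existsP=> [Xj|[i /andP[Xi]]].
  by exists j; rewrite Xj homo_ord_id ?eqxx.
by rewrite homo_ord_id // => /eqP<-.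
Qed.

End Realizable.

(** * Block symmetric functions that satisfy the matchgate identities *)

Section Parity.

Variable l : nat.
Implicit Types al be ga : bits l.

Definition par al : bool := \sum_i al i.

Lemma parD al be : par (al + be) = par al + par be.
Proof. by rewrite -big_split; apply: eq_bigr => i _; rewrite ffunE. Qed.

Lemma par_unit i : par (unit_bit i) = true.
Proof.
rewrite /par (bigD1 i) //= big1 => [|j /negPf ji]; first by rewrite ffunE eqxx.
by rewrite ffunE.
Qed.

Lemma odd_diff al be : odd #|diff al be| = par al + par be.
Proof.
rewrite -parD /par sum_bool_odd.
congr odd; apply: eq_card => i; rewrite -!topredE /= ffunE /diff.
by case: (al i); case: (be i).
Qed.

Lemma add_bitsxx al : al + al = 0.
Proof. by apply/ffunP=> i; rewrite !ffunE; case: (al i). Qed.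

Lemma add_bitsK be al : al + be + be = al.
Proof. by rewrite -addrA add_bitsxx addr0. Qed.

Lemma diffD al be ga : diff (al + ga) (be + ga) =1 diff al be.
Proof. by move=> i; rewrite /diff !ffunE; case: (al i); case: (be i); case: (ga i). Qed.

Lemma sgn_beforeD (F : fieldType) al be ga p :
  sgn_before F (al + ga) (be + ga) p = sgn_before F al be p.
Proof. by rewrite /sgn_before; congr (_ ^+ _); apply: eq_card => i; rewrite !inE diffD. Qed.

Lemma card_diff_flip al be a b : a != b -> diff al be a -> diff al be b ->
  (#|diff (al + unit_bit a + unit_bit b)%R be| < #|diff al be|)%N.
Proof.
move=> ab Da Db; apply: proper_card; apply/properP; split.
  apply/subsetP=> i; rewrite -!topredE /= /diff !ffunE.
  have [->//|_] := eqVneq i a; have [->//|_] := eqVneq i b.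
  by case: (al i); case: (be i).
exists a => //; move: Da; rewrite -topredE /= /diff !ffunE eqxx (negPf ab).
by case: (al a); case: (be a).
Qed.

End Parity.

Section CrossIdentity.

Variables (F : fieldType) (l : nat).
Implicit Types (x y : bits l -> F) (al be : bits l).

Definition cross x y al be : F :=
  \sum_(a | diff al be a)
     sgn_before F al be a * (x (al + unit_bit a) * y (be + unit_bit a)).

(* Given x al != 0, the identities determine y be recursively from y al and x,
   by the same recursion that gives x be from x al. *)
Lemma cross_proportional x y p :
    (forall al be, par al = ~~ p -> par be = ~~ p -> cross x y al be = 0) ->
    (forall al be, par al = ~~ p -> par be = ~~ p -> cross x x al be = 0) ->
  forall al be, par al = p -> par be = p -> x al * y be = x be * y al.
Proof.
move=> xy xx.
have core al be : x al != 0 -> par al = p -> par be = p -> x al * y be = x be * y al.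
  have [k] := ubnP #|diff al be|; elim: k be => // k IHk be lt_k xa_neq0 pa pb.
  have [a Da|D0] := pickP (diff al be).
    apply: (mulfI xa_neq0); apply/eqP; rewrite -subr_eq0; apply/eqP.
    apply: (mulfI (x := sgn_before F al be a)); first by rewrite signr_eq0.
    have pa' : par (al + unit_bit a) = ~~ p by rewrite parD par_unit pa; case: (p).
    have pb' : par (be + unit_bit a) = ~~ p by rewrite parD par_unit pb; case: (p).
    have : x al * cross x y (al + unit_bit a) (be + unit_bit a)
           - y al * cross x x (al + unit_bit a) (be + unit_bit a) = 0.
      by rewrite xy // xx // !mulr0 subr0.
    rewrite /cross !mulr_sumr -sumrB (bigD1 a) ?diffD //= big1 => [|b /andP[Db ba]].
      rewrite addr0 !add_bitsK sgn_beforeD mulr0 => <-.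
      by ring.
    rewrite diffD in Db; rewrite sgn_beforeD.
    suff eq_b : x al * y (be + unit_bit a + unit_bit b)
              = x (be + unit_bit a + unit_bit b) * y al.
      set u := x (al + _ + _); set v := y (be + _ + _) in eq_b *.
      set t := x (be + _ + _) in eq_b *.
      transitivity (sgn_before F al be b * u * (x al * v - t * y al)); first by ring.
      by rewrite eq_b subrr mulr0.
    apply: IHk => //; last first.
      by rewrite !parD !par_unit pb; case: (p).
    rewrite -ltnS; apply: leq_trans lt_k; rewrite ltnS.
    have diffC u v : #|diff u v| = #|diff v u|.
      by apply: eq_card => i; rewrite -!topredE /= /diff eq_sym.
    rewrite diffC (diffC _ al); apply: card_diff_flip; rewrite 1?eq_sym //.
      by rewrite /diff eq_sym.
    by rewrite /diff eq_sym.
  have -> : be = al; last by [].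
  by apply/ffunP=> i; have /negbFE/eqP-> := D0 i.
move=> al be pa pb; have [xa0|xa] := eqVneq (x al) 0; last exact: core.
have [xb0|xb] := eqVneq (x be) 0; first by rewrite xa0 xb0 !mul0r.
exact/esym/core.
Qed.

End CrossIdentity.

Section BlockSymmetric.

Variables (F : fieldType) (n l : nat).
Notation config := {ffun 'I_n -> bits l}.
Implicit Types (X Y Z U W : config) (j k : 'I_n) (al be : bits l) (a b : 'I_l).

Definition upd X j al : config := [ffun k => if k == j then al else X k].
Definition flip_at X j a := upd X j (X j + unit_bit a).
Definition permute (s : 'S_n) X : config := [ffun j => X (s j)].
Definition dpar X Y j : bool := par (X j) + par (Y j).

Definition odd_before X Y j : bool := \sum_(k < n | (k < j)%N) dpar X Y k.

Variable H : config -> F.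

Definition local_sum j X Y : F :=
  \sum_(a | diff (X j) (Y j) a)
     sgn_before F (X j) (Y j) a * (H (flip_at X j a) * H (flip_at Y j a)).

Hypothesis char_not2 : (2%:R : F) != 0.
Hypothesis H_sym : forall s X, H (permute s X) = H X.
Hypothesis H_mgi : forall X Y,
  \sum_(j < n) (-1) ^+ odd_before X Y j * local_sum j X Y = 0.

Lemma upd_same X j al : upd X j al j = al. Proof. by rewrite ffunE eqxx. Qed.
Lemma upd_other X j al k : k != j -> upd X j al k = X k.
Proof. by rewrite ffunE => /negPf->. Qed.
Lemma updK X j : upd X j (X j) = X.
Proof. by apply/ffunP=> k; rewrite ffunE; case: eqP => // ->. Qed.
Lemma upd_upd X j al be : upd (upd X j al) j be = upd X j be.
Proof. by apply/ffunP=> k; rewrite !ffunE; case: eqP. Qed.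
Lemma upd_permute s X j al : upd (permute s X) j al = permute s (upd X (s j) al).
Proof. by apply/ffunP=> k; rewrite !ffunE (inj_eq perm_inj). Qed.

Lemma local_sum_permute s j X Y :
  local_sum j (permute s X) (permute s Y) = local_sum (s j) X Y.
Proof.
by rewrite /local_sum /flip_at !ffunE; apply: eq_bigr => a _; rewrite !upd_permute !H_sym.
Qed.

Lemma local_sum_upd j X Y al be :
  local_sum j (upd X j al) (upd Y j be)
  = cross (fun ga => H (upd X j ga)) (fun ga => H (upd Y j ga)) al be.
Proof.
by rewrite /local_sum /cross !upd_same; apply: eq_bigr => a _;
  rewrite /flip_at !upd_same !upd_upd.
Qed.

Lemma dpar_permute s X Y j : dpar (permute s X) (permute s Y) j = dpar X Y (s j).
Proof. by rewrite /dpar !ffunE. Qed.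

Lemma local_sum_same j X Y : (forall k, k != j -> local_sum k X Y = 0) -> local_sum j X Y = 0.
Proof.
move=> T0; have := H_mgi X Y; rewrite (bigD1 j) //= big1 => [|k /T0->]; last by rewrite mulr0.
by rewrite addr0 => /eqP; rewrite mulf_eq0 signr_eq0 => /eqP.
Qed.

Lemma sum_set2 (V : nmodType) (f : 'I_n -> V) (i0 i1 : 'I_n) :
    i0 = 0%N :> nat -> i1 = 1%N :> nat ->
  \sum_j f j = f i0 + f i1 + \sum_(j : 'I_n | (1 < j)%N) f j.
Proof.
move=> e0 e1; rewrite (bigD1 i0) //= (bigD1 i1) /=; last by rewrite -val_eqE /= e0 e1.
by rewrite addrA; congr (_ + _); apply: eq_bigl => j; rewrite -!val_eqE /= e0 e1; lia.
Qed.

(* Putting an odd block k before or after the even block j changes the sign of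
   the j-th local sum and of no other one. *)
Lemma local_sum_even j k X Y : dpar X Y j = false -> dpar X Y k = true ->
  local_sum j X Y = 0.
Proof.
move=> Dj Dk; have jk : j != k by apply: contraTneq Dk => <-; rewrite Dj.
have n_gt1 : (1 < n)%N.
  by have := ltn_ord j; have := ltn_ord k; move: jk; rewrite -val_eqE /=; lia.
pose i0 : 'I_n := Ordinal (ltnW n_gt1); pose i1 : 'I_n := Ordinal n_gt1.
suff main X' Y' : dpar X' Y' i0 = false -> dpar X' Y' i1 = true -> local_sum i0 X' Y' = 0.
  pose s := (tperm i1 (tperm i0 j k) * tperm i0 j)%g.
  have s1 : s i1 = k by rewrite permM tpermL tpermK.
  have s0 : s i0 = j.
    have neq : tperm i0 j k != i0.
      by apply: contraNneq jk => e; rewrite -[k](tpermK i0 j) e tpermL.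
    by rewrite permM (tpermD _ neq) ?tpermL // -val_eqE.
  by rewrite -s0 -local_sum_permute; apply: main; rewrite dpar_permute ?s0 ?s1.
move: X' Y' => {jk X Y Dj Dk} X Y Dj Dk.
pose t := tperm i0 i1.
have := H_mgi X Y; rewrite (sum_set2 _ (erefl : i0 = 0%N :> nat) (erefl : i1 = 1%N :> nat)).
set rest := \sum_(j | _) _ => eq1.
have := H_mgi (permute t X) (permute t Y).
rewrite (sum_set2 _ (erefl : i0 = 0%N :> nat) (erefl : i1 = 1%N :> nat)).
have -> : \sum_(j < n | (1 < j)%N) (-1) ^+ odd_before (permute t X) (permute t Y) j
     * local_sum j (permute t X) (permute t Y) = rest.
  apply: eq_bigr => m m_gt1; rewrite local_sum_permute.
  have -> : t m = m by rewrite tpermD // -val_eqE /=; lia.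
  congr (_ ^+ nat_of_bool _ * _); rewrite /odd_before; under eq_bigr do rewrite dpar_permute.
  rewrite [RHS](reindex_inj (@perm_inj _ t)) /=; apply: eq_bigl => i.
  by rewrite /t; case: tpermP => [->|->|] //=; lia.
have sum0 f : \sum_(k : 'I_n | (k < i0)%N) f k = 0 :> bool by rewrite big_pred0.
have sum1 f : \sum_(k : 'I_n | (k < i1)%N) f k = f i0 :> bool.
  by rewrite (big_pred1 i0) // => i /=; rewrite -val_eqE /=; lia.
move: eq1; rewrite /odd_before !sum0 !sum1 !dpar_permute !local_sum_permute tpermL tpermR Dj Dk.
rewrite !expr0 !expr1 !mul1r => eq1 eq2; apply/eqP.
have : local_sum i0 X Y *+ 2 = 0.
  rewrite -[RHS](subrr 0) -{1}eq1 -eq2 mulN1r; ring.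
by move/eqP; rewrite -mulr_natl mulf_eq0 (negPf char_not2).
Qed.

Definition swappable j X Y := H X * H Y = H (upd X j (Y j)) * H (upd Y j (X j)).

Lemma swappable_cross j X Y : par (X j) = par (Y j) ->
    (forall al be, par al = ~~ par (X j) -> par be = ~~ par (X j) ->
       local_sum j (upd X j al) (upd Y j be) = 0) ->
  swappable j X Y.
Proof.
move=> pXY XY0; rewrite /swappable -{1}(updK X j) -{1}(updK Y j).
apply: (@cross_proportional F l (fun ga => H (upd X j ga))
                 (fun ga => H (upd Y j ga)) (par (X j))) => //.
  by move=> al be pa pb; rewrite -local_sum_upd XY0.
move=> al be pa pb; rewrite -local_sum_upd; apply: local_sum_same => k kj.
by rewrite /local_sum big_pred0 // => a; rewrite !upd_other // /diff eqxx.
Qed.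

Lemma swappable_odd j k X Y :
  par (X j) = par (Y j) -> par (X k) != par (Y k) -> swappable j X Y.
Proof.
move=> pXY pk; have kj : k != j by apply: contraNneq pk => ->; rewrite pXY.
apply: swappable_cross => // al be pa pb; apply: (local_sum_even (k := k)).
  by rewrite /dpar !upd_same pa pb; case: (par (X j)).
by rewrite /dpar !upd_other //; case: (par (X k)) (par (Y k)) pk => [] [].
Qed.

Lemma swappable_via j k X Y Z : H Z != 0 ->
    par (X j) = par (Y j) -> par (Z j) = par (X j) ->
    par (X k) = par (Y k) -> par (Z k) != par (X k) ->
  swappable j X Y.
Proof.
move=> Z_neq0 pXY pZX pk pZk.
have kj : k != j by apply: contraNneq pZk => ->; rewrite pZX.
have sw X' al : par al = par (X j) -> par (X' k) = par (X k) ->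
    H (upd X' j al) * H Z = H (upd X' j (Z j)) * H (upd Z j al).
  move=> pa pX'; have := @swappable_odd j k (upd X' j al) Z.
  rewrite /swappable !upd_same !upd_upd; apply; first by rewrite pa pZX.
  by rewrite upd_other // pX' eq_sym.
have sX := sw X (X j) erefl erefl; have sX' := sw X (Y j) (esym pXY) erefl.
have sY := sw Y (Y j) (esym pXY) (esym pk); have sY' := sw Y (X j) erefl (esym pk).
rewrite updK in sX; rewrite updK in sY.
apply: (mulIf Z_neq0); apply: (mulIf Z_neq0); rewrite /swappable.
transitivity ((H X * H Z) * (H Y * H Z)); first by ring.
transitivity ((H (upd X j (Y j)) * H Z) * (H (upd Y j (X j)) * H Z)); last by ring.
by rewrite sX sY sX' sY'; ring.
Qed.

Lemma permute_tperm1 j k X : permute (tperm j k) X j = X k.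
Proof. by rewrite ffunE tpermL. Qed.
Lemma permute_tperm2 j k X : permute (tperm j k) X k = X j.
Proof. by rewrite ffunE tpermR. Qed.
Lemma permute_tpermD j k i X : i != j -> i != k -> permute (tperm j k) X i = X i.
Proof. by move=> ij ik; rewrite ffunE tpermD // eq_sym. Qed.

Hypothesis n_ge3 : (3 <= n)%N.

Lemma third_index j k : exists2 m : 'I_n, m != j & m != k.
Proof.
have : (0 < #|~: [set j; k]|)%N.
  by rewrite -(ltn_add2l #|[set j; k]|) cardsC card_ord addn0 cards2; case: (_ == _); lia.
by case/card_gt0P=> m; rewrite !inE negb_or => /andP[mj mk]; exists m.
Qed.

(* The parities being equal on all blocks, it suffices to have a nonzero entry Z
   with the parity of X on block j and another parity on some block k.  If there
   is none, X has the same parity q on all blocks but j.  If par (X j) = q, the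
   local sums of the other blocks vanish, by looking at a third block; if not,
   such a Z exists for every block but j, and these can be exchanged instead. *)
Lemma swappable_par j X Y : par (X j) = par (Y j) -> swappable j X Y.
Proof.
move=> pXY.
have [/existsP[k pk]|] := boolP [exists k, par (X k) != par (Y k)].
  exact: swappable_odd pk.
rewrite negb_exists => /forallP/(_ _)/negPn/eqP pXYk.
have [/existsP[Z /existsP[k /and3P[Z0 /eqP pZj pZk]]]|noZ] := boolP [exists Z : config,
    [exists k, [&& H Z != 0, par (Z j) == par (X j) & par (Z k) != par (X k)]]].
  exact: swappable_via Z0 pXY pZj (pXYk k) pZk.
have pZ Z k : H Z != 0 -> par (Z j) = par (X j) -> par (Z k) = par (X k).
  move=> Z0 pZj; apply/eqP; apply: contraNT noZ => pZk.
  by apply/existsP; exists Z; apply/existsP; exists k; rewrite Z0 pZj eqxx.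
have [/existsP[W /andP[W0 /eqP pWj]]|noW] :=
    boolP [exists W : config, (H W != 0) && (par (W j) == par (X j))]; last first.
  have H0 W : par (W j) = par (X j) -> H W = 0.
    move=> pW; apply/eqP; apply: contraNT noW => W0.
    by apply/existsP; exists W; rewrite W0 pW /=.
  by rewrite /swappable (H0 X) // (H0 (upd X j (Y j))) ?upd_same // !mul0r.
have pW k := pZ W k W0 pWj.
have pX k m : k != j -> m != j -> par (X k) = par (X m).
  move=> kj mj; rewrite -[RHS]pW -[LHS](pZ (permute (tperm k m) W)) ?H_sym //.
    by rewrite permute_tperm1.
  by rewrite permute_tpermD // eq_sym.
have [m0 m0j _] := third_index j j.
have [pjm|pjm] := eqVneq (par (X j)) (par (X m0)).
  apply: swappable_cross => // al be pa pb; apply: local_sum_same => k kj.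
  rewrite /local_sum big1 // => a _; set Z := flip_at (upd X j al) k a.
  have [->|Z0] := eqVneq (H Z) 0; first by rewrite mul0r mulr0.
  have [m mj mk] := third_index j k.
  have Zm : Z m = X m by rewrite upd_other // upd_other.
  have Zj : Z j = al by rewrite upd_other 1?eq_sym // upd_same.
  have := pZ (permute (tperm j m) Z) m; rewrite H_sym permute_tperm1 permute_tperm2 Zm Zj pa.
  rewrite pjm (pX m m0) // => /(_ Z0 erefl); by case: (par (X m0)).
have sw k X' Y' : k != j -> (forall i, par (X' i) = par (X i)) ->
    (forall i, par (Y' i) = par (X i)) -> swappable k X' Y'.
  move=> kj pX' pY'; have [m mj mk] := third_index j k.
  apply: (@swappable_via k j X' Y' (permute (tperm j m) W)); rewrite ?H_sym ?pX' ?pY' //.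
    by rewrite permute_tpermD // eq_sym.
  by rewrite permute_tperm1 pW (pX m m0) // eq_sym.
pose mix (s : seq 'I_n) A B : config := [ffun k => if k \in s then B k else A k].
have mixP s : j \notin s -> H X * H Y = H (mix s X Y) * H (mix s Y X).
  elim: s => [_|k s IHs].
    by congr (H _ * H _); apply/ffunP=> i; rewrite ffunE.
  rewrite inE negb_or eq_sym => /andP[kj js]; rewrite IHs //.
  have [ks|ks] := boolP (k \in s).
    by congr (H _ * H _); apply/ffunP=> i; rewrite !ffunE inE; case: (i =P k) => // ->;
      rewrite ks.
  rewrite (sw k) //; last 2 first.
  - by move=> i; rewrite ffunE; case: ifP.
  - by move=> i; rewrite ffunE; case: ifP.
  by congr (H _ * H _); apply/ffunP=> i; rewrite !ffunE inE; case: (i =P k) => // ->;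
    rewrite (negPf ks).
rewrite /swappable (mixP [seq k <- enum 'I_n | k != j]); last by rewrite mem_filter eqxx.
by rewrite mulrC; congr (H _ * H _); apply/ffunP=> i; rewrite !ffunE mem_filter mem_enum andbT;
  case: (i =P j) => // ->.
Qed.

Lemma flip_atK X j a : flip_at (flip_at X j a) j a = X.
Proof. by rewrite /flip_at upd_same upd_upd add_bitsK updK. Qed.

Lemma exchange U V j : H U != 0 -> H V != 0 -> par (U j) != par (V j) ->
  exists W a k b, [/\ k != j, H W != 0 & H (flip_at (flip_at W j a) k b) != 0].
Proof.
have [c] := ubnP #|diff (U j) (V j)|; elim: c U => // c IHc U lt_c U0 V0 pUV.
have [a Da|D0] := pickP (diff (U j) (V j)); last first.
  case/eqP: pUV; congr par; apply/ffunP=> i.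
  by have /negbFE/eqP-> := D0 i.
set X := flip_at U j a; set Y := flip_at V j a.
have [/existsP[k /existsP[b /andP[kj Xkb]]]|no_k] :=
    boolP [exists k, [exists b, (k != j) && (H (flip_at X k b) != 0)]].
  by exists U, a, k, b.
have [/existsP[b /and3P[ba Db Xjb]]|no_b] :=
    boolP [exists b, [&& b != a, diff (U j) (V j) b & H (flip_at X j b) != 0]].
  have UE : flip_at X j b = upd U j (U j + unit_bit a + unit_bit b).
    by rewrite /flip_at !upd_same upd_upd.
  rewrite UE in Xjb; apply: IHc Xjb V0 _; rewrite upd_same.
    by rewrite -ltnS (leq_trans _ lt_c) // ltnS card_diff_flip // eq_sym.
  by rewrite !parD !par_unit; move: pUV; case: (par (U j)); case: (par (V j)).
have : local_sum j X Y = 0.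
  apply: local_sum_same => k kj; rewrite /local_sum big1 // => b _.
  have -> : H (flip_at X k b) = 0; last by rewrite mul0r mulr0.
  apply/eqP; apply: contraNT no_k => Xkb.
  by apply/existsP; exists k; apply/existsP; exists b; rewrite kj.
have DXY : diff (X j) (Y j) =1 diff (U j) (V j).
  by move=> b; rewrite !upd_same diffD.
rewrite /local_sum (bigD1 a) ?DXY //= big1 => [|b /andP[Db ba]]; last first.
  have -> : H (flip_at X j b) = 0; last by rewrite mul0r mulr0.
  apply/eqP; apply: contraNT no_b => Xjb; apply/existsP; exists b.
  by rewrite ba Xjb -DXY Db.
rewrite addr0 !flip_atK => /eqP.
by rewrite !mulf_eq0 signr_eq0 (negPf U0) (negPf V0).
Qed.

Section Factorization.

Variables (i0 i1 : 'I_n) (U : config) (a b : 'I_l).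

Definition slice be : F :=
  if par be == par (U i0) then H (upd U i0 be) else H (upd (flip_at U i1 b) i0 be).
Definition rep (c : bool) : bits l :=
  if c == par (U i0) then U i0 else U i0 + unit_bit a.

Lemma par_rep c : par (rep c) = c.
Proof.
rewrite /rep; case: eqP => [->//|/eqP]; rewrite parD par_unit.
by case: (par _); case: c.
Qed.

Lemma slice_step X i :
  H X * slice (rep (par (X i))) = H (upd X i (rep (par (X i)))) * slice (X i).
Proof.
pose Uc := if par (X i) == par (U i0) then U else flip_at U i1 b.
have sliceE be : par be = par (X i) -> slice be = H (upd Uc i0 be).
  by rewrite /slice /Uc => ->; case: ifP.
pose Y := permute (tperm i0 i) (upd Uc i0 (rep (par (X i)))).
have Yi : Y i = rep (par (X i)) by rewrite permute_tperm2 upd_same.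
have := @swappable_par i X Y; rewrite /swappable Yi par_rep => /(_ erefl).
rewrite upd_permute tpermR upd_upd !H_sym -!sliceE ?par_rep //.
Qed.

Hypothesis slice_neq0 : forall X i, H X != 0 -> slice (rep (par (X i))) != 0.

Lemma block_factorization X :
  H X = (\prod_i slice (X i)) *
        ((\prod_i (slice (rep (par (X i))))^-1) * H [ffun i => rep (par (X i))]).
Proof.
have stepP s : uniq s -> H X * \prod_(i <- s) slice (rep (par (X i)))
    = H [ffun i => if i \in s then rep (par (X i)) else X i] * \prod_(i <- s) slice (X i).
  elim: s => [_|i s IHs /= /andP[i_s /IHs{}IHs]].
    by rewrite !big_nil; congr (H _ * _); apply/ffunP=> i; rewrite ffunE.
  rewrite !big_cons mulrCA IHs.
  set X' := [ffun _ => _]; have X'i : X' i = X i by rewrite ffunE (negPf i_s).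
  have := slice_step X' i; rewrite X'i => step.
  transitivity (H X' * slice (rep (par (X i))) * \prod_(i <- s) slice (X i)); first by ring.
  rewrite step -mulrA; congr (H _ * _).
  by apply/ffunP=> k; rewrite !ffunE inE; case: eqP => // ->.
have := stepP _ (enum_uniq 'I_n); rewrite !big_enum /=.
have -> : [ffun i => if i \in enum 'I_n then rep (par (X i)) else X i]
          = [ffun i => rep (par (X i))] :> config.
  by apply/ffunP=> i; rewrite !ffunE mem_enum.
move=> main; have [X0|X0] := eqVneq (H X) 0; last first.
  have prod_neq0 : \prod_i slice (rep (par (X i))) != 0.
    by apply/prodf_neq0 => i _; apply: slice_neq0.
  by apply: (mulIf prod_neq0); rewrite main prodfV; field.
have [prod0|prod_neq0] := eqVneq (\prod_i slice (rep (par (X i)))) 0.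
  by rewrite prodfV prod0 invr0 mul0r mulr0.
by apply: (mulIf prod_neq0); rewrite main prodfV; field.
Qed.

End Factorization.

Lemma slice_exists (i0 i1 : 'I_n) (a0 : 'I_l) : i1 != i0 ->
  exists U a b, (H U = 0 -> forall X, H X = 0) /\
    forall X i, H X != 0 -> slice i0 i1 U b (rep i0 U a (par (X i))) != 0.
Proof.
move=> i10.
have [/existsP[U /existsP[V /and3P[U0 V0 pUV]]]|same] := boolP [exists U : config,
    [exists V : config, [&& H U != 0, H V != 0 & par (U i0) != par (V i0)]]].
  have [W [a [k [b [ki0 W0 Wab]]]]] := exchange U0 V0 pUV.
  exists (permute (tperm i1 k) W), a, b; rewrite H_sym; split=> [/eqP|X i _].
    by rewrite (negPf W0).
  rewrite /slice /rep.
  have Wi0 : permute (tperm i1 k) W i0 = W i0 by rewrite permute_tpermD // eq_sym.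
  rewrite Wi0; case: (par (X i) =P _) => [_|_]; first by rewrite eqxx -Wi0 updK H_sym.
  have -> : (par (W i0 + unit_bit a) == par (W i0)) = false.
    by rewrite parD par_unit; case: (par (W i0)).
  rewrite (_ : upd _ _ _ = permute (tperm i1 k) (flip_at (flip_at W i0 a) k b)) ?H_sym //.
  have t0 : tperm i1 k i0 = i0 by rewrite tpermD // eq_sym.
  have tk j : (tperm i1 k j == k) = (j == i1).
    by rewrite -{2}(tpermL i1 k) (inj_eq perm_inj).
  have tj0 j : (tperm i1 k j == i0) = (j == i0) by rewrite -{1}t0 (inj_eq perm_inj).
  apply/ffunP=> j; rewrite !ffunE tk tj0 (negPf ki0) tpermL.
  by case: (j =P i0) => // ->; rewrite eq_sym (negPf i10).
have same_par U X i : H U != 0 -> H X != 0 -> par (X i) = par (U i0).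
  move=> U0 X0; apply/eqP; apply: contraNT same => pXU; apply/existsP.
  exists U; apply/existsP; exists (permute (tperm i0 i) X).
  by rewrite U0 H_sym X0 permute_tperm1 eq_sym.
have [/existsP[U U0]|noU] := boolP [exists U : config, H U != 0]; last first.
  have H0 X : H X = 0.
    by apply/eqP; apply: contraNT noU => X0; apply/existsP; exists X.
  by exists 0, a0, a0; split=> // X i; rewrite H0 eqxx.
exists U, a0, a0; split=> [/eqP|X i X0]; first by rewrite (negPf U0).
by rewrite /slice par_rep (same_par U X) // eqxx /rep eqxx updK.
Qed.

End BlockSymmetric.

(** * The factorization *)

Definition tuple_bits N (t : N.-tuple bool) : bits N := [ffun i => tnth t i].

Lemma signatureE (F : fieldType) N (G : matchgate F N) t :
  signature G t = sig G (tuple_bits t).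
Proof.
by rewrite /signature /sig; congr perf_match; apply/setP=> v;
  apply/imsetP/imsetP=> -[i]; rewrite inE => ti ->; exists i; rewrite // inE ?ffunE // in ti *.
Qed.

Lemma par_tuple_bits l (al : l.-tuple bool) : par (tuple_bits al) = parity al.
Proof.
rewrite /par /parity -sum1_count (big_morph odd oddD (erefl _)).
rewrite [RHS]big_tuple [RHS]big_mkcond /=; apply: eq_bigr => i _.
by rewrite ffunE; case: (tnth al i).
Qed.

Section Flat.

Variables n l : nat.

Lemma flat_index_subproof (i : 'I_n) (a : 'I_l) : (i * l + a < n * l)%N.
Proof. by have := ltn_ord i; have := ltn_ord a; nia. Qed.

Definition flat_index (i : 'I_n) (a : 'I_l) : 'I_(n * l) :=
  Ordinal (flat_index_subproof i a).

Lemma flat_index_lt i a k b :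
  (flat_index k b < flat_index i a)%N = (k < i)%N || (k == i) && (b < a)%N.
Proof.
rewrite -val_eqE /=; have := ltn_ord b; have := ltn_ord a.
by case: (ltngtP k i) => /= [lt|lt|->]; rewrite ?ltn_add2l // => la lb; nia.
Qed.

Lemma block_size_gt0 (q : 'I_(n * l)) : (0 < l)%N.
Proof.
by have := leq_ltn_trans (leq0n q) (ltn_ord q); rewrite muln_gt0 => /andP[].
Qed.

Lemma block_subproof (q : 'I_(n * l)) : (q %/ l < n)%N.
Proof. by rewrite ltn_divLR ?(block_size_gt0 q). Qed.

Lemma offset_subproof (q : 'I_(n * l)) : (q %% l < l)%N.
Proof. by rewrite ltn_mod (block_size_gt0 q). Qed.

Definition block_of q : 'I_n := Ordinal (block_subproof q).
Definition offset_of q : 'I_l := Ordinal (offset_subproof q).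

Lemma block_flat i a : block_of (flat_index i a) = i.
Proof.
by apply: val_inj; rewrite /= divnMDl ?divn_small ?addn0 //; apply: leq_ltn_trans (ltn_ord a).
Qed.

Lemma offset_flat i a : offset_of (flat_index i a) = a.
Proof. by apply: val_inj; rewrite /= modnMDl modn_small. Qed.

Lemma flat_block q : flat_index (block_of q) (offset_of q) = q.
Proof. by apply: val_inj; rewrite /= -divn_eq. Qed.

Lemma sum_flat (V : nmodType) (P : pred 'I_(n * l)) (f : 'I_(n * l) -> V) :
  \sum_(q | P q) f q
  = \sum_i \sum_(a | P (flat_index i a)) f (flat_index i a).
Proof.
rewrite (reindex (fun u : 'I_n * 'I_l => flat_index u.1 u.2)) /=.
  by rewrite pair_big_dep.
exists (fun q => (block_of q, offset_of q)) => [[i a] _|q _].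
  by rewrite /= block_flat offset_flat.
exact: flat_block.
Qed.

Notation config := {ffun 'I_n -> bits l}.

Definition flat (X : config) : bits (n * l) := [ffun q => X (block_of q) (offset_of q)].

Lemma flatE (X : config) i a : flat X (flat_index i a) = X i a.
Proof. by rewrite ffunE block_flat offset_flat. Qed.

Lemma eq_flat (B : bits (n * l)) (X : config) :
  (forall i a, B (flat_index i a) = X i a) -> B = flat X.
Proof. by move=> BX; apply/ffunP=> q; rewrite -(flat_block q) flatE BX. Qed.

Lemma flat_index_inj i a k b : (flat_index i a == flat_index k b) = (i == k) && (a == b).
Proof.
apply/eqP/andP=> [e|[/eqP-> /eqP->]] //.
by rewrite -(block_flat i a) -[X in _ == X](block_flat k b) e eqxx
  -[a in a == _](offset_flat i a) -[X in _ == X](offset_flat k b) e eqxx.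
Qed.

Lemma flat_unit (X : config) i a : flat X + unit_bit (flat_index i a) = flat (flip_at X i a).
Proof.
apply: eq_flat => k b; rewrite ffunE flatE !ffunE flat_index_inj.
by case: (k =P i) => [->|_]; rewrite ?ffunE //=; case: (X k b).
Qed.

Lemma sgn_before_flat (F : fieldType) (X Y : config) i a :
  sgn_before F (flat X) (flat Y) (flat_index i a)
  = (-1) ^+ odd_before X Y i * sgn_before F (X i) (Y i) a.
Proof.
rewrite /sgn_before -signr_odd -[X in _ * X]signr_odd -signr_addb.
congr (_ ^+ nat_of_bool _); rewrite -!sum_bool_odd sum_flat.
rewrite (bigID (fun k : 'I_n => (k < i)%N)) /=; congr (_ (+) _).
  apply: eq_bigr => k lt_ki; rewrite /dpar -odd_diff -sum1_card.
  rewrite (big_morph odd oddD (erefl _)); apply: eq_big => b; first by rewrite /diff !flatE.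
  by rewrite flat_index_lt lt_ki.
rewrite (bigD1 i) ?ltnn //= -[RHS]addbF; congr (_ (+) _).
  by apply: eq_big => b; rewrite ?/diff ?flatE // flat_index_lt ltnn eqxx.
rewrite big1 // => k /andP[nki ki]; rewrite big1 // => b _.
by rewrite flat_index_lt (negPf nki) (negPf ki).
Qed.

Lemma block_identity (F : fieldType) (G : matchgate F (n * l)) (X Y : config) :
    (2%:R : F) != 0 ->
  \sum_(j < n) (-1) ^+ odd_before X Y j * local_sum (fun Z => sig G (flat Z)) j X Y = 0.
Proof.
move=> char_not2; rewrite -[RHS](matchgate_identity G (flat X) (flat Y) char_not2) sum_flat.
apply: eq_bigr => i _; rewrite /local_sum mulr_sumr; apply: eq_big => a.
  by rewrite /diff !flatE.
by move=> _; rewrite sgn_before_flat !flat_unit -mulrA.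
Qed.

Definition config_tuple (X : config) : n.-tuple (l.-tuple bool) :=
  [tuple [tuple X i a | a < l] | i < n].

Definition tuple_config (t : n.-tuple (l.-tuple bool)) : config :=
  [ffun i => tuple_bits (tnth t i)].

Lemma tuple_bits_blocks t : tuple_bits (blocks t) = flat (tuple_config t).
Proof.
apply: eq_flat => i a; rewrite !ffunE (tnth_nth false) /= [in RHS](tnth_nth false).
rewrite (tnth_nth (tnth t i)); have : (i < size t)%N by rewrite size_tuple.
elim: (tval t) (nat_of_ord i) => // u s IHs [|k] /=.
  by rewrite mul0n add0n nth_cat size_tuple ltn_ord.
rewrite ltnS => /IHs {}IHs; rewrite nth_cat size_tuple mulSn -addnA.
by rewrite ltnNge leq_addr /= addKn IHs.
Qed.

Lemma config_tupleK : cancel config_tuple tuple_config.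
Proof. by move=> X; apply/ffunP=> i; apply/ffunP=> a; rewrite !ffunE !tnth_mktuple. Qed.

End Flat.

Section Extend.

Variable l : nat.

Definition extend (al : bits l) (c : bool) : bits l.+1 :=
  [ffun j => if unlift ord_max j is Some a then al a else c].

Lemma extend_lift al c a : extend al c (lift ord_max a) = al a.
Proof. by rewrite ffunE liftK. Qed.

Lemma extend_max al c : extend al c ord_max = c.
Proof. by rewrite ffunE unlift_none. Qed.

Lemma tuple_bits_rcons (t : l.-tuple bool) c :
  tuple_bits (rcons_tuple t c) = extend (tuple_bits t) c.
Proof.
apply/ffunP=> j; rewrite [LHS]ffunE (tnth_nth false) /= nth_rcons size_tuple.
case: (unliftP ord_max j) => [a ->|->].
  by rewrite extend_lift ffunE lift_max ltn_ord (tnth_nth false).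
by rewrite extend_max /= ltnn eqxx.
Qed.

Lemma par_extend al c : par (extend al c) = par al + c.
Proof.
rewrite /par big_ord_recr /= extend_max; congr (_ + _); apply: eq_bigr => a _.
rewrite -[RHS](extend_lift al c); congr (extend _ _ _); apply: val_inj.
exact/esym/lift_max.
Qed.

End Extend.

Lemma embed_in M N (h : 'I_M -> 'I_N) X i : injective h -> embed h X (h i) = X i.
Proof.
move=> inj_h; rewrite ffunE; apply/existsP/idP=> [[j /andP[Xj /eqP/inj_h<-]]|Xi] //.
by exists i; rewrite Xi eqxx.
Qed.

Lemma embed_out M N (h : 'I_M -> 'I_N) X q : q \notin codom h -> embed h X q = false.
Proof.
move=> qh; rewrite ffunE; apply: contraNF qh => /existsP[i /andP[_ /eqP<-]].
exact: codom_f.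
Qed.

Theorem theorem6 (F : fieldType) (char_not2 : (2%:R : F) != 0) (n l : nat)
    (n_ge3 : (3 <= n)%N) (Gam : (n * l).-tuple bool -> F)
    (Gam_sym : blockwise_symmetric Gam)
    (Gam_real : exists G : matchgate F (n * l), realizes G Gam) :
  exists (g : l.-tuple bool -> F) (GamS : n.-tuple bool -> F),
    [/\ exists G : matchgate F l.+1, realizes_condensed G g,
        exists G : matchgate F n, realizes G GamS,
        bitwise_symmetric GamS
      & forall a : n.-tuple (l.-tuple bool),
          Gam (blocks a)
          = (\prod_(i < n) g (tnth a i))
            * GamS [tuple parity (tnth a i) | i < n]].
Proof.
pose i0 : 'I_n := Ordinal (ltnW (ltnW n_ge3)); pose i1 : 'I_n := Ordinal (ltnW n_ge3).
have i10 : i1 != i0 by [].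
have [l0|l_gt0] := posnP l.
  subst l; pose a0 : n.-tuple (0.-tuple bool) := [tuple [tuple] | _ < n].
  pose c := Gam (blocks a0).
  exists (fun _ => 1), (fun t => c * [forall i, ~~ tnth t i]%:R); split.
  - exists (star F 1) => t; rewrite signatureE sig_star /odd_matchgate /= card_ord.
    rewrite (_ : [forall i, _]) //; apply/forallP=> i.
    by rewrite tuple_bits_rcons ord1 (_ : 0 = ord_max) ?extend_max ?tuple0 //; apply: val_inj.
  - have real1 : realizable (sig (star F n)) by exists (star F n).
    have := realizable_weight (fun i b => if i == i0 then c else 1)
              (realizable_shift [ffun _ => true] real1).
    case=> G GE; exists G => t; rewrite signatureE -GE sig_star.
    rewrite (bigD1 i0) //= big1 => [|i /negPf->] //; rewrite mulr1.
    congr (_ * (nat_of_bool _)%:R).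
    by apply: eq_forallb => i; rewrite !ffunE; case: (tnth t i).
  - move=> s t; congr (_ * (nat_of_bool _)%:R).
    apply/forallP/forallP=> tP i; first by rewrite tnth_mktuple.
    by have := tP ((s^-1)%g i); rewrite tnth_mktuple permKV.
  - move=> a; rewrite big1 // mul1r (_ : [forall i, _]) ?mulr1.
      by rewrite /c; congr (Gam (blocks _)); apply: eq_from_tnth => i;
        rewrite [LHS]tuple0 [RHS]tuple0.
    by apply/forallP=> i; rewrite tnth_mktuple tuple0.
have [G0 G0E] := Gam_real.
pose H (X : {ffun 'I_n -> bits l}) := sig G0 (flat X).
have realG : realizable (sig G0) by exists G0.
have GamE t : Gam (blocks t) = H (tuple_config t).
  by rewrite G0E signatureE tuple_bits_blocks.
have H_sym s X : H (permute s X) = H X.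
  rewrite -(config_tupleK X) -GamE (Gam_sym s) GamE; congr H.
  by apply/ffunP=> i; rewrite !ffunE tnth_mktuple.
have H_mgi X Y := block_identity G0 X Y char_not2.
have [U [a [b [U0 slice0]]]] :=
  slice_exists H_sym H_mgi (Ordinal l_gt0) i10.
pose sl := slice H i0 i1 U b; pose rp := rep i0 U a.
have idx_inj := @flat_index_inj n l.
exists (fun t => sl (tuple_bits t)), (fun t => (\prod_i (sl (rp (tnth t i)))^-1)
                                        * H [ffun i => rp (tnth t i)]); split.
- pose h (j : 'I_l.+1) :=
    if unlift ord_max j is Some a' then flat_index i0 a' else flat_index i1 b.
  have h_lift a' : h (lift ord_max a') = flat_index i0 a' by rewrite /h liftK.
  have h_max : h ord_max = flat_index i1 b by rewrite /h unlift_none.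
  have homo_h : {homo h : i j / (i < j)%N}.
    move=> i j; case: (unliftP ord_max i) => [a1 ->|->]; last by rewrite ltnNge -ltnS ltn_ord.
    case: (unliftP ord_max j) => [a2 ->|->]; rewrite !h_lift ?h_max ?lift_max => lt12.
      by rewrite flat_index_lt eqxx lt12 orbT.
    by rewrite flat_index_lt.
  have inj_h : injective h.
    move=> i j hij; apply: val_inj; apply/eqP; rewrite eqn_leq leqNgt [X in _ && X]leqNgt.
    by apply/andP; split; apply/negP=> /homo_h; rewrite hij ltnn.
  pose set_b c : bits l := [ffun a' => if a' == b then c else U i1 a'].
  pose R0 := upd (upd U i1 (set_b false)) i0 0.
  have [G' G'E] := realizable_sub homo_h (realizable_shift (flat R0) realG).
  have sigG' al c : sig G' (extend al c) = H (upd (upd U i1 (set_b c)) i0 al).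
    rewrite -G'E /H; congr sig; apply: eq_flat => i a'; rewrite ffunE flatE.
    have [->|ii0] := eqVneq i i0.
      by rewrite -h_lift embed_in // extend_lift !upd_same ffunE addr0.
    rewrite !(upd_other _ _ ii0); have [->|ii1] := eqVneq i i1; last first.
      rewrite embed_out ?add0r ?upd_other //; apply/codomP=> -[j].
      case: (unliftP ord_max j) => [a1 ->|->]; rewrite ?h_lift ?h_max => /eqP;
        by rewrite idx_inj ?(negPf ii0) ?(negPf ii1).
    rewrite !upd_same ![set_b _ _]ffunE; have [->|ab] := eqVneq a' b.
      by apply: etrans (addbF _) _; rewrite -h_max embed_in // extend_max.
    rewrite -[RHS]addFb; congr (_ (+) _); apply: embed_out; apply/codomP=> -[j].
    case: (unliftP ord_max j) => [a1 ->|->]; rewrite ?h_lift ?h_max => /eqP;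
      by rewrite idx_inj ?(negPf ab) ?andbF // (negPf i10).
  have set_bU : upd U i1 (set_b (U i1 b)) = U.
    rewrite -[RHS](updK U i1); congr upd; apply/ffunP=> a'; rewrite ffunE.
    by case: eqP => // ->.
  have set_b_flip : upd U i1 (set_b (~~ U i1 b)) = flip_at U i1 b.
    congr upd; apply/ffunP=> a'; rewrite !ffunE; case: eqP => [->|_].
      by case: (U i1 b).
    by case: (U i1 a').
  exists G' => t; rewrite signatureE tuple_bits_rcons sigG'.
  have [HU0|HU] := eqVneq (H U) 0.
    by rewrite /sl /slice !(U0 HU0) if_same.
  have : sig G' (extend (U i0) (U i1 b)) != 0 by rewrite sigG' set_bU updK.
  move/sig_parity; rewrite -[LHS](sum_bool_odd predT) -/(par _) par_extend => parG'.
  rewrite /sl /slice -par_tuple_bits /odd_matchgate -parG'.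
  have -> : (if par (U i0) + U i1 b then ~~ par (tuple_bits t) else par (tuple_bits t))
      = if par (tuple_bits t) == par (U i0) then U i1 b else ~~ U i1 b.
    by case: (par (U i0)); case: (U i1 b); case: (par (tuple_bits t)).
  by case: ifP; rewrite ?set_bU ?set_b_flip.
- pose h (i : 'I_n) := flat_index i a.
  have homo_h : {homo h : i j / (i < j)%N}.
    by move=> i j lt_ij; rewrite flat_index_lt lt_ij.
  have inj_h : injective h.
    by move=> i j /eqP; rewrite idx_inj => /andP[/eqP].
  have := realizable_weight (fun _ c => (sl (rp c))^-1)
    (realizable_sub homo_h (realizable_shift (flat [ffun _ => rp false]) realG)).
  case=> G'' G''E; exists G'' => t; rewrite signatureE -G''E; congr (_ * _).
    by apply: eq_bigr => i _; rewrite ffunE.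
  congr sig; apply/esym/eq_flat => i a'; rewrite ffunE flatE.
  have rpE c : rp c = rp false + [ffun a' => c && (a' == a)].
    apply/ffunP=> a1; rewrite /rp /rep; case: c; case: (par (U i0)) => /=;
    by rewrite !ffunE /=; case: (U i0 a1); case: (a1 == a).
  rewrite (ffunE (fun=> rp false)) (ffunE (fun i => rp (tnth t i))).
  rewrite addrC (rpE (tnth t i)) [RHS]ffunE; congr (_ + _); rewrite [RHS]ffunE.
  have [->|aa] := eqVneq a' a.
    by rewrite -/(h i) embed_in // ffunE andbT.
  rewrite andbF embed_out //; apply/codomP=> -[j] /eqP.
  by rewrite idx_inj (negPf aa) andbF.
- move=> s t; congr (_ * _).
    rewrite (reindex_inj (@perm_inj _ s)) /=.
    by apply: eq_bigr => i _; rewrite tnth_mktuple.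
  rewrite -[LHS](H_sym s); congr H; apply/ffunP=> i.
  by rewrite !ffunE tnth_mktuple.
- move=> t; rewrite GamE.
  rewrite (block_factorization char_not2 H_sym H_mgi n_ge3 slice0).
  congr (_ * (_ * _)); last 1 first.
  + by congr H; apply/ffunP=> i; rewrite !ffunE tnth_mktuple par_tuple_bits.
  + by apply: eq_bigr => i _; rewrite ffunE.
  by apply: eq_bigr => i _; rewrite tnth_mktuple ffunE par_tuple_bits.
Qed.
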